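(* Let $2\le n\in\mathbb{N}$, let $\Omega\subset\mathbb{R}^n$ be a bounded domain with smooth boundary $\partial\Omega$ such that $\Omega$ lies on one side of $\partial\Omega$, and let $2\le m\in\mathbb{N}$. Assume: (INIT) $v=(v_i)\in C(\overline\Omega,\mathbb{R}_+^m)$. (DIFF) $d_i>0$ for $i=1,\dots,m$, and $\varphi\in C(\overline\Omega\times\overline\Omega,\mathbb{R}_+)$ satisfies $\varphi(x,y)=\varphi(y,x)$ for all $x,y\in\Omega$, and $\varepsilon,\mu\ge0$ are constants such that $0\le\varepsilon\le\int_\Omega\varphi(x,y)\,dy\le\mu$ for all $x\in\Omega$. (F) $f=(f_i):\mathbb{R}^m\to\mathbb{R}^m$ is locally Lipschitz, i.e. there is $C\in C(\mathbb{R}^m\times\mathbb{R}^m,\mathbb{R}_+)$ with $|f(u)-f(w)|\le C(u,w)|u-w|$ for all $u,w\in\mathbb{R}^m$. (QP) For each $i\in\{1,\dots,m\}$, $f_i(u)\ge0$ whenever $u\in\mathbb{R}_+^m$ with $u_i=0$. (QBAL) There are $a_i>0$ ($i=1,\dots,m$), $K\ge0$ and $L\in\mathbb{R}$ such that $\sum_{i=1}^m a_if_i(u)\le K+L\sum_{i=1}^m u_i$ for all $u\in\mathbb{R}_+^m$. Then the system $$\begin{cases}\dfrac{\partial}{\partial t}u_i(x,t)=\displaystyle\int_\Omega d_i\varphi(x,y)\,(u_i(y,t)-u_i(x,t))\,dy+f_i(u(x,t)), & x\in\Omega,\ t\ge0,\ i=1,\dots,m,\\ u_i(x,0)=v_i(x),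 & x\in\Omega,\ i=1,\dots,m,\end{cases}$$ has a unique classical component-wise nonnegative global solution $u\in C^{(0,1)}(\overline\Omega\times\mathbb{R}_+,\mathbb{R}_+^m)$. Furthermore, if either ($\varepsilon>0$ and $K=L=0$) or $L<0$, then $u$ is uniformly sup norm bounded, i.e. $\sup_{t\ge0}\|u(\cdot,t)\|_{\infty,\Omega}<\infty$.
   Context: $\mathbb{R}_+^m=\{z\in\mathbb{R}^m: z_i\ge0 \text{ for all } i\}$ and $\mathbb{R}_+=[0,\infty)$. $C^{(0,1)}(\overline\Omega\times[0,T))$ denotes functions that are continuous on $\overline\Omega\times[0,T)$ together with their first-order derivative in $t$. A classical solution on $[0,T)$ (with $0<T\le\infty$) is a function $u$, each of whose components is in $C^{(0,1)}(\overline\Omega\times[0,T))$, that satisfies the system for $t<T$ (by continuity, stating it on $\Omega$ is equivalent to stating it on $\overline\Omega$); it is global if $T=\infty$. $\|\cdot\|_{\infty,\Omega}$ is the sup norm over $\Omega$. *)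

(* Defs.v *)
From HB Require Import structures.
From mathcomp Require Import all_boot all_order all_algebra.
From mathcomp Require Import all_classical all_reals all_analysis.

Set Implicit Arguments.
Unset Strict Implicit.
Unset Printing Implicit Defensive.

Import Order.TTheory GRing.Theory Num.Theory.
Import numFieldNormedType.Exports.

Local Open Scope classical_set_scope.
Local Open Scope ring_scope.

(* The library has no Lebesgue measure on R^n. The sigma-algebra on 'rV[R]_n
   generated by the coordinate maps is the product of the Borel
   sigma-algebras, that is, the Borel sigma-algebra of R^n. *)
Section rV_measurable.
Context {R : realType}.
Variable n : nat.

Let coord (i : 'I_n) (x : 'rV[R]_n) : measurableTypeR R := x ord0 i.

Let rV_set0 : g_sigma_preimage coord set0.
Proof. exact: sigma_algebra0. Qed.

Let rV_setC A : g_sigma_preimage coord A -> g_sigma_preimage coord (~` A).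
Proof. exact: sigma_algebraC. Qed.

Let rV_bigcup (F : (set 'rV[R]_n)^nat) :
  (forall i, g_sigma_preimage coord (F i)) ->
  g_sigma_preimage coord (\bigcup_i (F i)).
Proof. exact: sigma_algebra_bigcup. Qed.

HB.instance Definition _ := @isMeasurable.Build default_measure_display
  'rV[R]_n (g_sigma_preimage coord) rV_set0 rV_setC rV_bigcup.

End rV_measurable.

Lemma measurable_fun_rVP {R : realType} d (T : measurableType d) n
    (f : T -> 'rV[R]_n) :
  measurable_fun [set: T] f <->
  forall i, measurable_fun [set: T] (fun x => f x ord0 i : measurableTypeR R).
Proof.
pose coord (i : 'I_n) (x : 'rV[R]_n) : measurableTypeR R := x ord0 i.
apply: (@iff_trans _ (g_sigma_preimage (fun i => coord i \o f) `<=` measurable)).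
  rewrite g_sigma_preimage_comp; split=> [mf A [/= C preC <-]|prefS].
    exact: mf.
  by move=> _ A mA; apply: prefS; exists A.
split=> [fS i|mf].
- move=> _ A mA; apply: fS; apply: sub_sigma_algebra.
  case: n i => [[] []//|n i] in f coord *.
  rewrite -bigcup_mkord_ord.
  exists i; first exact: ltn_ord.
  by exists A => //; rewrite inord_val.
- apply: smallest_sub; first exact: sigma_algebra_measurable.
  case: n => [|n] in f coord mf *; first by rewrite big_ord0.
  rewrite -bigcup_mkord_ord; apply: bigcup_sub => i Ii.
  by move=> A [B mB <-]; exact: mf.
Qed.

Definition rV_cons {R : realType} n (p : measurableTypeR R * 'rV[R]_n) :
  'rV[R]_n.+1 := row_mx (p.1 : R)%:M p.2.

Definition rV_uncons {R : realType} n (x : 'rV[R]_n.+1) :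
  measurableTypeR R * 'rV[R]_n :=
  (x ord0 ord0, \row_i x ord0 (lift ord0 i)).

Lemma rV_cons0 {R : realType} n (p : measurableTypeR R * 'rV[R]_n) :
  rV_cons p ord0 ord0 = p.1.
Proof.
have := @row_mxEl R 1 1 n (p.1 : R)%:M p.2 ord0 ord0.
rewrite [RHS]mxE eqxx mulr1n => <-; congr (_ _ _); exact/val_inj.
Qed.

Lemma rV_consS {R : realType} n (p : measurableTypeR R * 'rV[R]_n) i :
  rV_cons p ord0 (lift ord0 i) = p.2 ord0 i.
Proof.
rewrite -(@row_mxEr R 1 1 n (p.1 : R)%:M p.2 ord0 i).
congr (_ _ _); exact/val_inj.
Qed.

Lemma rV_unconsK {R : realType} n : cancel (@rV_uncons R n) (@rV_cons R n).
Proof.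
move=> x; apply/rowP => i; case: (unliftP ord0 i) => [j|] ->.
  by rewrite rV_consS mxE.
by rewrite rV_cons0.
Qed.

Lemma rV_consK {R : realType} n : cancel (@rV_cons R n) (@rV_uncons R n).
Proof.
move=> [x y]; rewrite /rV_uncons rV_cons0; congr pair.
by apply/rowP => i; rewrite mxE rV_consS.
Qed.

Lemma measurable_rV_coord {R : realType} n (i : 'I_n) :
  measurable_fun [set: 'rV[R]_n] (fun x => x ord0 i : measurableTypeR R).
Proof. by move: i; apply/(@measurable_fun_rVP R _ _ n id); exact: measurable_id. Qed.

Lemma measurable_rV_cons {R : realType} n :
  measurable_fun [set: measurableTypeR R * 'rV[R]_n] (@rV_cons R n).
Proof.
apply/measurable_fun_rVP => i; case: (unliftP ord0 i) => [j|] ->.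
  under eq_fun do rewrite rV_consS.
  exact: (measurableT_comp (measurable_rV_coord j) measurable_snd).
by under eq_fun do rewrite rV_cons0; exact: measurable_fst.
Qed.

Lemma measurable_rV_uncons {R : realType} n :
  measurable_fun [set: 'rV[R]_n.+1] (@rV_uncons R n).
Proof.
apply: measurable_fun_pair; first exact: measurable_rV_coord.
apply/measurable_fun_rVP => i; under eq_fun do rewrite mxE.
exact: measurable_rV_coord.
Qed.

Section lebesgue_rV_succ.
Context {R : realType} (n : nat).
Variable mu : {sigma_finite_measure set 'rV[R]_n -> \bar R}.

Definition lebesgue_rV_succ : set 'rV[R]_n.+1 -> \bar R :=
  pushforward (lebesgue_measure \x mu)%E (@rV_cons R n).

Let succ0 : lebesgue_rV_succ set0 = 0%E.
Proof. by rewrite /lebesgue_rV_succ /pushforward preimage_set0 measure0. Qed.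

Let succ_ge0 A : (0 <= lebesgue_rV_succ A)%E.
Proof. exact: (measure_ge0 (lebesgue_measure \x mu)%E). Qed.

Let succ_sigma_additive : semi_sigma_additive lebesgue_rV_succ.
Proof.
move=> F mF tF mUF; rewrite /lebesgue_rV_succ /pushforward preimage_bigcup.
apply: measure_semi_sigma_additive.
- by move=> k; rewrite -[X in measurable X]setTI; exact: measurable_rV_cons.
- apply/trivIsetP => /= i j _ _ ij; rewrite -preimage_setI.
  by move/trivIsetP : tF => /(_ _ _ _ _ ij) ->//; rewrite preimage_set0.
- rewrite -preimage_bigcup -[X in measurable X]setTI.
  exact: measurable_rV_cons.
Qed.

HB.instance Definition _ := isMeasure.Build _ _ _ lebesgue_rV_succ
  succ0 succ_ge0 succ_sigma_additive.

Let succ_sigma_finite : sigma_finite setT lebesgue_rV_succ.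
Proof.
have /sigma_finiteP[F [TF ndF Foo]] := sigma_finiteT (@lebesgue_measure R).
have /sigma_finiteP[G [TG ndG Goo]] := sigma_finiteT mu.
exists (fun k => @rV_uncons R n @^-1` (F k `*` G k)).
  rewrite -preimage_bigcup (_ : \bigcup_k _ = setT) ?preimage_setT//.
  rewrite -setXTT TF TG predeqE => -[x y]; split.
    by move=> [k _ []/= ? ?]; split; exists k.
  move=> [/= [i _ Fix] [k _ Gky]]; exists (maxn i k) => //; split.
  - by move: x Fix; exact/subsetPset/ndF/leq_maxl.
  - by move: y Gky; exact/subsetPset/ndG/leq_maxr.
move=> k; have [? ?] := Foo k; have [? ?] := Goo k.
have mFG : measurable (F k `*` G k) by exact: measurableX.
split.
  by rewrite -[X in measurable X]setTI; exact: measurable_rV_uncons.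
rewrite /lebesgue_rV_succ /pushforward -comp_preimage.
rewrite (_ : _ \o _ = id); last by apply/funext => p; exact: rV_consK.
by rewrite preimage_id product_measure1E// lte_mul_pinfty// ge0_fin_numE.
Qed.

HB.instance Definition _ := Measure_isSigmaFinite.Build _ _ _ lebesgue_rV_succ
  succ_sigma_finite.

End lebesgue_rV_succ.

(* n-dimensional Lebesgue measure: R^0 is a point of mass 1, and R^(n+1) is
   identified with R * R^n carrying the product measure. *)
Fixpoint lebesgue_rV (R : realType) (n : nat) :
    {sigma_finite_measure set 'rV[R]_n -> \bar R} :=
  match n with
  | 0 => \d_(0 : 'rV[R]_0)
  | n'.+1 => lebesgue_rV_succ (lebesgue_rV R n')
  end.

Section domains.
Context {R : realType} {n : nat}.
Implicit Types (Omega U : set 'rV[R]_n) (g : 'rV[R]_n -> R).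

Definition bounded_domain Omega :=
  [/\ Omega !=set0, open Omega, connected Omega & bounded_set Omega].

Definition boundary Omega := closure Omega `\` interior Omega.

Definition partial (i : 'I_n) g : 'rV[R]_n -> R := 'D_(delta_mx ord0 i) g.

(* U is meant to be open. *)
Fixpoint C_on (k : nat) U g : Prop :=
  (forall x, U x -> {for x, continuous g}) /\
  match k with
  | 0 => True
  | k'.+1 => forall i : 'I_n,
      (forall x, U x -> derivable g x (delta_mx ord0 i)) /\
      C_on k' U (partial i g)
  end.

Definition smooth_on U g := forall k, C_on k U g.

(* Near each of its points, the boundary is the regular zero set of a
   C^infinity function rho, and Omega is the side where rho < 0. *)
Definition smooth_boundary_one_side Omega :=
  forall p, boundary Omega p ->
    exists (U : set 'rV[R]_n) (rho : 'rV[R]_n -> R),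
      [/\ open U /\ U p,
          smooth_on U rho,
          forall x, U x -> exists i, partial i rho x != 0,
          U `&` boundary Omega = U `&` [set x | rho x = 0] &
          U `&` Omega = U `&` [set x | rho x < 0]].

End domains.

Section solutions.
Context {R : realType}.

Definition orthant m : set 'rV[R]_m := [set z | forall i, 0 <= z ord0 i].

(* [0, T), for T possibly infinite *)
Definition time_interval (T : \bar R) : set R :=
  [set t | 0 <= t /\ (t%:E < T)%E].

(* l is the derivative at t of the function g defined on J; it is one-sided
   when t is an endpoint of J. *)
Definition has_derivative_in (J : set R) (g : R -> R) (t l : R) :=
  (fun s => (s - t)^-1 * (g s - g t)) @ within J t^' --> l.

Definition C01 n (D : set 'rV[R]_n) (J : set R) (g : 'rV[R]_n -> R -> R) :=
  {within D `*` J, continuous (fun p : 'rV[R]_n * R => g p.1 p.2)} /\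
  exists dg : 'rV[R]_n -> R -> R,
    {within D `*` J, continuous (fun p : 'rV[R]_n * R => dg p.1 p.2)} /\
    forall x t, D x -> J t -> has_derivative_in J (g x) t (dg x t).

Definition classical_solution n m (Omega : set 'rV[R]_n) (d : 'I_m -> R)
    (phi : 'rV[R]_n -> 'rV[R]_n -> R) (f : 'rV[R]_m -> 'rV[R]_m)
    (v : 'rV[R]_n -> 'rV[R]_m) (T : \bar R) (u : 'rV[R]_n -> R -> 'rV[R]_m) :=
  [/\ forall i, C01 (closure Omega) (time_interval T)
                  (fun x t => u x t ord0 i),
      forall x t i, Omega x -> time_interval T t ->
        has_derivative_in (time_interval T) (fun s => u x s ord0 i) t
          (\int[lebesgue_rV R n]_(y in Omega)
              (d i * phi x y * (u y t ord0 i - u x t ord0 i))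
           + f (u x t) ord0 i) &
      forall x i, Omega x -> u x 0 ord0 i = v x ord0 i].

Definition nonneg_solution n m (Omega : set 'rV[R]_n) (T : \bar R)
    (u : 'rV[R]_n -> R -> 'rV[R]_m) :=
  forall x t, closure Omega x -> time_interval T t -> orthant (u x t).

Definition sup_norm n m (Omega : set 'rV[R]_n) (g : 'rV[R]_n -> 'rV[R]_m) :
  \bar R := ereal_sup [set `|g x|%:E | x in Omega].

End solutions.

Arguments orthant {R} m.

(* Main.v *)
(* Extend the data continuously to all of R^n (Tietze) and truncate the
   nonlinearity: f is replaced by f composed with the clamping of every
   component to [0, M t]. The truncated system is an ordinary differential
   equation for curves of continuous functions, solved globally by Picard
   iteration in the weighted norm sup e^(-2 Lam t) |u|. Quasi-positivity makes
   its solution nonnegative, and the balance condition then bounds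
   sum_i a_i u_i by A e^(k t) with A and k independent of M; choosing
   M t = A e^(k t) / min a_i makes the truncation inactive.

   For the uniform bound, the symmetry of phi cancels the diffusion in
   W(t) = int_Omega sum_i a_i u_i, so that W' <= K |Omega| - l W with
   l proportional to - L, and W is bounded. Hence the gain term of the nonlocal
   diffusion is bounded, while its loss term and the reaction contribute
   - (eps min d_i + l) sum_i a_i u_i at every point of Omega. *)

Require Import Defs.
From mathcomp Require Import all_boot all_order all_algebra.
From mathcomp Require Import all_classical all_reals all_analysis.
From mathcomp Require Import ring lra measurable_realfun.
Import Order.TTheory GRing.Theory Num.Theory.
Import numFieldNormedType.Exports.
Local Open Scope classical_set_scope.
Local Open Scope ring_scope.
Set Implicit Arguments.
Unset Strict Implicit.
Unset Printing Implicit Defensive.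

(** * Continuity of compositions and coordinates *)

(** The supremum over x of a solution, or of a difference of two, need not be differentiable in
    time, so every estimate is made at a fixed x. From a bound B e^(c t) valid at all points, a
    barrier argument at one point yields B/2 e^(c t); iterating removes B. The factor 1/2 appears
    because c is twice the Lipschitz or growth constant, and the same choice makes the Picard step a
    contraction.

    The cap M t depends on time, so on each bounded time interval the truncated right-hand side has
    one Lipschitz constant. The solution is therefore global at once, without continuation or a
    blow-up alternative. The growth rate k does not see M because the balance condition is used at
    the clamped vector, which lies in the orthant and is componentwise below u as soon as u is
    nonnegative.

    After the extension all functions are continuous on whole spaces, but these are not compact;
    uniform bounds on the kernel, on the initial value and on u - v are therefore carried along
    separately. A competing solution lives only over the closure of Omega, so uniqueness is an
    estimate over Omega alone. *)

Lemma continuous_compose (T U S : topologicalType) (f : T -> U) (g : U -> S) :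
  continuous f -> continuous g -> continuous (fun x => g (f x)).
Proof. by move=> cf cg x; apply: continuous_comp; [exact: cf|exact: cg]. Qed.

Lemma continuous_pair (T U S : topologicalType) (f : T -> U) (g : T -> S) :
  continuous f -> continuous g -> continuous (fun x => (f x, g x)).
Proof. by move=> cf cg x; apply: cvg_pair; [exact: cf|exact: cg]. Qed.

Lemma continuous_id (T : topologicalType) : continuous (fun x : T => x).
Proof. by move=> x; exact: cvg_id. Qed.

Lemma continuous_cst (T U : topologicalType) (c : U) :
  continuous (fun x : T => c).
Proof. by move=> x; exact: cvg_cst. Qed.

Section real_valued_continuity.
Context {R : realType} {T : topologicalType}.
Implicit Types f g : T -> R.

Lemma continuous_add f g : continuous f -> continuous g ->
  continuous (fun x => f x + g x).
Proof. by move=> cf cg x; apply: cvgD; [exact: cf|exact: cg]. Qed.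

Lemma continuous_opp f : continuous f -> continuous (fun x => - f x).
Proof. by move=> cf x; apply: cvgN; exact: cf. Qed.

Lemma continuous_sub f g : continuous f -> continuous g ->
  continuous (fun x => f x - g x).
Proof. by move=> cf cg; apply: continuous_add => //; exact: continuous_opp. Qed.

Lemma continuous_mul f g : continuous f -> continuous g ->
  continuous (fun x => f x * g x).
Proof. by move=> cf cg x; apply: cvgM; [exact: cf|exact: cg]. Qed.

Lemma continuous_norm f : continuous f -> continuous (fun x => `|f x|).
Proof. by move=> cf x; apply: (@cvg_norm _ R^o); exact: cf. Qed.

Lemma continuous_maxr f g : continuous f -> continuous g ->
  continuous (fun x => Num.max (f x) (g x)).
Proof. by move=> cf cg x; apply: continuous_max; [exact: cf|exact: cg]. Qed.

Lemma continuous_minr f g : continuous f -> continuous g ->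
  continuous (fun x => Num.min (f x) (g x)).
Proof. by move=> cf cg x; apply: continuous_min; [exact: cf|exact: cg]. Qed.

Lemma continuous_sum m (F : 'I_m -> T -> R) : (forall i, continuous (F i)) ->
  continuous (fun x => \sum_(i < m) F i x).
Proof.
elim: m F => [|m IH] F cF.
  by under eq_fun do rewrite big_ord0; exact: continuous_cst.
under eq_fun do rewrite big_ord_recl.
by apply: continuous_add; [exact: cF|apply: IH => i; exact: cF].
Qed.

End real_valued_continuity.

Lemma continuous_max0 {R : realType} : continuous (fun t : R => Num.max 0 t).
Proof.
by apply: continuous_maxr; [exact: continuous_cst|exact: continuous_id].
Qed.

Lemma continuous_fst (T1 T2 : topologicalType) : continuous (fun p : T1 * T2 => p.1).
Proof. by move=> p; exact: cvg_fst. Qed.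

Lemma continuous_snd (T1 T2 : topologicalType) : continuous (fun p : T1 * T2 => p.2).
Proof. by move=> p; exact: cvg_snd. Qed.

(** * Differential inequalities and one-sided derivatives *)

Section real_functions.
Context {R : realType}.
Implicit Types (g dg : R -> R) (s t T : R).

(** If [g t1 > 0], let [s0] be the last time before [t1] with [g <= 0]. On the interval after [s0]
    the function is positive, hence nonincreasing, and cannot reach a positive value. Asking for the
    derivative only where [g > 0] lets applications use the sign of [g] when they estimate [dg]. *)
Lemma barrier g dg T : continuous g -> g 0 <= 0 ->
  (forall t, 0 < t -> t < T -> 0 < g t -> is_derive t 1 g (dg t)) ->
  (forall t, 0 < t -> t < T -> 0 < g t -> dg t <= 0) ->
  forall t, 0 <= t -> t <= T -> g t <= 0.
Proof.
move=> cg g0 dgE dg0 t1 t10 t1T; rewrite leNgt; apply/negP => gt1.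
pose S := [set s | [/\ 0 <= s, s <= t1 & g s <= 0]].
have S0 : S 0 by split.
have hS : has_sup S by split; [exists 0|exists t1 => s []].
set s0 := sup S.
have s0ge : 0 <= s0 by apply: ub_le_sup => //; exact: hS.2.
have s0le : s0 <= t1 by apply: ge_sup; [exists 0|move=> s []].
have gs0 : g s0 <= 0.
  rewrite leNgt; apply/negP => gs0.
  have /nbhs_ballP[e /= e0 He] : nbhs s0 [set s | 0 < g s].
    exact: (cvgr_gt (g s0) (cg s0)).
  have [s [s1 s2 s3] ss] := sup_adherent e0 hS.
  have ss0 : s <= s0 by apply: ub_le_sup; [exact: hS.2|split].
  have /He /= : ball s0 e s by rewrite /ball/= ger0_norm ?subr_ge0// ltrBlDl -ltrBlDr.
  by rewrite ltNge s3.
have gpos s : s0 < s -> s <= t1 -> 0 < g s.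
  move=> s0s st1; rewrite ltNge; apply/negP => gs.
  have : s <= s0 by apply: ub_le_sup; [exact: hS.2|split => //; exact: le_trans (ltW s0s)].
  by rewrite leNgt s0s.
have H x : x \in `]s0, t1[ -> is_derive x 1 g (dg x) /\ dg x <= 0.
  rewrite in_itv/= => /andP[s0x xt1].
  have x0 : 0 < x by exact: le_lt_trans s0x.
  have xT : x < T by exact: lt_le_trans t1T.
  have gx : 0 < g x by apply: gpos => //; exact: ltW.
  by split; [exact: dgE|exact: dg0].
have : g t1 <= g s0.
  apply: (@ler0_derive1_le_cc _ g s0 t1) => //.
  - by move=> x /H[dx _]; exact: ex_derive.
  - by move=> x /H[dx ?]; rewrite derive1E derive_val.
  - exact: continuous_subspaceT.
  - by rewrite in_itv/= s0le lexx.
  - by rewrite in_itv/= lexx s0le.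
by rewrite leNgt (le_lt_trans gs0 gt1).
Qed.

(** Where [g] exceeds the claimed bound it exceeds [c / r], so [dg <= 0] there and [barrier]
    applies. For [r = 0] the quotient is 0 by convention, and [c = 0] makes [g] nonincreasing. *)
Lemma linear_comparison (g dg : R -> R) (c r t : R) : continuous g ->
  (forall s : R, 0 < s -> is_derive s 1 g (dg s)) ->
  (forall s, 0 < s -> dg s <= c - r * g s) ->
  0 <= c -> 0 <= r -> (r = 0 -> c = 0) -> 0 <= t -> g t <= `|g 0| + c / r.
Proof.
move=> cg dgE dgc c0 r0 rc t0; rewrite -subr_le0.
apply: (@barrier (fun s => g s - (`|g 0| + c / r)) dg t) => //.
- by move=> s; apply: cvgB; [exact: cg|exact: cvg_cst].
- have : 0 <= c / r by rewrite divr_ge0.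
  by have := ler_norm (g 0); lra.
- move=> s s0 _ _; rewrite -[dg s]subr0.
  by apply: is_deriveB; exact: dgE.
- move=> s s0 _ gs; apply: (le_trans (dgc s s0)).
  have [E|rN0] := eqVneq r 0; first by rewrite rc// E mul0r subrr.
  have rp : 0 < r by rewrite lt_neqAle eq_sym rN0.
  have : c / r <= g s by have := normr_ge0 (g 0); lra.
  by rewrite ler_pdivrMr// mulrC; lra.
Qed.

Lemma geometric_le0 (x C : R) : (forall k, x <= C / 2 ^+ k) -> x <= 0.
Proof.
move=> xC; rewrite leNgt; apply/negP => x0.
have c : (fun k => C / 2 ^+ k) @ \oo --> (0 : R).
  have -> : (fun k => C / 2 ^+ k) = geometric C (2^-1).
    by apply/funext => k /=; rewrite /= exprVn.
  by apply: cvg_geometric; rewrite ger0_norm ?invr_ge0// invf_lt1// ltr1n.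
have [N _ /(_ N (leqnn N))/=] := cvgr_lt 0 c _ x0.
by rewrite ltNge xC.
Qed.

Lemma geometric_small (C e : R) : 0 < e -> exists k, C / 2 ^+ k <= e.
Proof.
move=> e0; apply: contrapT => /forallNP H.
suff : e <= 0 by rewrite leNgt e0.
by apply: (@geometric_le0 _ C) => k; apply: ltW; rewrite ltNge; exact/negP/H.
Qed.

(** The intervals of radius [2 * C / 2 ^+ k] around [a k] are nested; the limit is the supremum of
    their left ends. *)
Lemma geometric_limit (a : nat -> R) (C : R) : 0 <= C ->
  (forall k, `|a k.+1 - a k| <= C / 2 ^+ k) ->
  exists l, forall k, `|a k - l| <= 2 * C / 2 ^+ k.
Proof.
move=> C0 aC; pose b k := a k - 2 * C / 2 ^+ k; pose c k := a k + 2 * C / 2 ^+ k.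
have E k : 2 * C / 2 ^+ k.+1 = C / 2 ^+ k.
  by rewrite exprS invfM mulrACA mulfV// mul1r.
have E2 k : 2 * C / 2 ^+ k = C / 2 ^+ k + C / 2 ^+ k.
  by rewrite -mulrA mulr_natl mulr2n.
have nb : {homo b : i j / (i <= j)%N >-> i <= j}.
  apply: homo_leq => [x|x y z|k]; [exact: lexx|exact: le_trans|].
  by rewrite /b E E2; have := aC k; rewrite ler_norml => /andP[]; lra.
have nc : {homo c : i j / (i <= j)%N >-> j <= i}.
  apply: homo_leq => [x|x y z xy zx|k]; [exact: lexx|exact: le_trans zx xy|].
  by rewrite /c E E2; have := aC k; rewrite ler_norml => /andP[]; lra.
have bc i : b i <= c i.
  by rewrite /b /c lerD2l ge0_cp// !mulr_ge0// invr_ge0 exprn_ge0.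
have bc' i j : b i <= c j.
  have [ij|/ltnW ji] := leqP i j; first exact: le_trans (nb _ _ ij) (bc j).
  exact: le_trans (bc i) (nc _ _ ji).
have hS : has_sup (range b).
  by split; [exists (b 0%N); exists 0%N|exists (c 0%N) => _ [i _ <-]; exact: bc'].
exists (sup (range b)) => k; rewrite distrC ler_distl; apply/andP; split.
  by apply: ub_le_sup; [exact: hS.2|exists k].
by apply: ge_sup; [exact: hS.1|move=> _ [i _ <-]; exact: bc'].
Qed.

(** Limits are unique, so a limit known with some uncontrolled constant [C'] inherits the constant
    given by the increments. *)
Lemma geometric_limit_rate (a : nat -> R) (C C' l : R) : 0 <= C ->
  (forall k, `|a k.+1 - a k| <= C / 2 ^+ k) ->
  (forall k, `|a k - l| <= C' / 2 ^+ k) ->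
  forall k, `|a k - l| <= 2 * C / 2 ^+ k.
Proof.
move=> C0 aC al; have [l' al'] := geometric_limit C0 aC.
suff -> : l = l' by [].
apply/eqP; rewrite -subr_eq0 -normr_le0.
apply: (@geometric_le0 _ (C' + 2 * C)) => k.
rewrite -(subrKA (a k)) (le_trans (ler_normD _ _))// mulrDl lerD//.
by rewrite distrC.
Qed.

(* Plays the role of Gronwall's lemma for the supremum of p / e, which need not
   be differentiable in time. *)
Lemma halving (Z : Type) (D : set Z) (p e : Z -> R) (B0 : R) :
  (forall z, D z -> 1 <= e z) -> (forall z, D z -> p z <= B0) ->
  (forall B, 0 <= B -> (forall z, D z -> p z <= B * e z) ->
     forall z, D z -> p z <= B / 2 * e z) ->
  forall z, D z -> p z <= 0.
Proof.
move=> e1 pB0 pB z Dz.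
have H k : forall z, D z -> p z <= `|B0| / 2 ^+ k * e z.
  elim: k => [w Dw|k IH w Dw].
    rewrite expr0 divr1 (le_trans (pB0 _ Dw))// (le_trans (ler_norm _))//.
    by rewrite ler_peMr// e1.
  rewrite exprS invfM [2^-1 * _]mulrC mulrA; exact: pB.
by apply: (@geometric_le0 _ (`|B0| * e z)) => k; rewrite mulrAC; exact: H.
Qed.

(** The inverse of 1 plus the sum of the inverses replaces the minimum, which would need a nonempty
    index type. *)
Lemma positive_lower_bound m (a : 'I_m -> R) : (forall i, 0 < a i) ->
  exists2 c, 0 < c & forall i, c <= a i.
Proof.
move=> a0; have s0 : 0 <= \sum_i (a i)^-1.
  by apply: sumr_ge0 => i _; rewrite invr_ge0 ltW.
exists (1 + \sum_i (a i)^-1)^-1 => [|i]; first by rewrite invr_gt0 ltr_wpDr.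
rewrite -[leRHS]invrK lef_pV2 ?posrE ?invr_gt0 ?ltr_wpDr//.
rewrite (bigD1 i)//= addrCA lerDl addr_ge0//.
by apply: sumr_ge0 => j _; rewrite invr_ge0 ltW.
Qed.

End real_functions.

(** * Sup norm and continuity of row vectors by coordinates *)

Section rV_norm.
Context {R : realType} {m : nat}.
Implicit Types x : 'rV[R]_m.

Lemma le_coord_rV_norm x i : `|x ord0 i| <= `|x|.
Proof.
rewrite [leRHS]/Num.norm/= mx_normrE.
exact: (le_bigmax _ (fun ij => `|x ij.1 ij.2|) (ord0, i)).
Qed.

Lemma rV_norm_le x c : 0 <= c -> (forall i, `|x ord0 i| <= c) -> `|x| <= c.
Proof.
move=> c0 xc; rewrite [leLHS]/Num.norm/= mx_normrE.
by apply/bigmax_leP; split => // -[i j] _ /=; rewrite ord1.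
Qed.

Lemma continuous_rV (T : topologicalType) (u : T -> 'rV[R]_m) :
  (forall i, continuous (fun z => u z ord0 i)) -> continuous u.
Proof.
move=> cu z; apply/cvgrPdist_le => e e0.
have : \forall z' \near z, forall i, `|u z ord0 i - u z' ord0 i| <= e.
  by apply: filter_forall => i; move: e e0; apply/cvgrPdist_le; exact: cu.
apply: filterS => z' H; apply: rV_norm_le; first exact: ltW.
by move=> i; rewrite !mxE.
Qed.

Lemma continuous_rV_coord (T : topologicalType) (u : T -> 'rV[R]_m) i :
  continuous u -> continuous (fun z => u z ord0 i).
Proof.
move=> cu z; apply: (@continuous_comp _ _ _ u (fun M : 'rV_m => M ord0 i)).
  exact: cu.
exact: coord_continuous.
Qed.

End rV_norm.

(** * Derivatives and antiderivatives on the half line *)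

Section one_sided_derivatives.
Context {R : realType}.
Implicit Types (g F : R -> R) (t l : R).
Let J : set R := time_interval (+oo%E : \bar R).

Lemma time_intervaly t : J t <-> 0 <= t.
Proof. by split => [[]|t0]//; split; rewrite ?ltry. Qed.

Lemma is_derive_has_derivative_in g t l : is_derive t 1 g l ->
  has_derivative_in J g t l.
Proof.
move=> [/cvg_ex[/= l' gl'] gl].
have El : l' = l by rewrite -gl; apply/esym/cvg_lim.
rewrite {}El in gl'.
apply: cvg_within_filter; apply/cvgrPdist_le => e e0.
have /cvgrPdist_le/(_ _ e0)/nbhs_ballP[d /= d0 H] := gl'.
apply/nbhs_ballP; exists d => //= s ts st.
have := H (s - t); rewrite /ball /= sub0r opprB.
rewrite [_ *: 1]mulr1 subrK; apply => //.
by rewrite subr_eq0.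
Qed.

Lemma has_derivative_in_is_derive g t l : 0 < t ->
  has_derivative_in J g t l -> is_derive t 1 g l.
Proof.
move=> t0 /cvgrPdist_le H.
suff C : h^-1 *: ((g \o shift t) (h *: 1) - g t) @[h --> (0:R)^'] --> l.
  by split; [apply/cvg_ex; exists l|exact: cvg_lim].
apply/cvgrPdist_le => e e0.
have /nbhs_ballP[d /= d0 Hd] := H _ e0.
(* Increments smaller than [t] keep [h + t] in the half line, where the one-sided quotient is
   controlled. *)
apply/nbhs_ballP; exists (Num.min d t); first by rewrite /= lt_min d0 t0.
move=> h /=; rewrite /ball /= sub0r normrN lt_min => /andP[hd ht] h0.
rewrite [_ *: 1]mulr1.
have := Hd (h + t); rewrite /ball/= addrK opprD addrCA subrr addr0 normrN.
apply => //; last by apply/time_intervaly; move: ht; rewrite ltr_norml; lra.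
by rewrite -subr_eq0 addrK.
Qed.

Lemma eq_has_derivative_in g F t l : 0 <= t ->
  (forall s, 0 <= s -> g s = F s) ->
  has_derivative_in J F t l -> has_derivative_in J g t l.
Proof.
move=> t0 gF; apply: cvg_trans; apply: near_eq_cvg.
near=> s; rewrite !gF//; apply/time_intervaly.
by near: s; exact: withinT.
Unshelve. all: by end_near. Qed.

(* Integrating from -1 puts 0 inside the interval, where the fundamental theorem
   of calculus applies; the function is constant for t <= 0. *)
Definition antiderivative g t : R :=
  \int[lebesgue_measure]_(s in `[-1, Num.max 0 t]) g s -
  \int[lebesgue_measure]_(s in `[-1, 0]) g s.

Let FTC g t : continuous g -> 0 <= t -> is_derive t 1 (fun t =>
    \int[lebesgue_measure]_(s in `[-1, t]) g s -
    \int[lebesgue_measure]_(s in `[-1, 0]) g s) (g t).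
Proof.
move=> cg t0.
have t1 : t < t + 1 by rewrite ltrDl.
have N1t : -1 < t by rewrite (lt_le_trans _ t0)// ltrN10.
have ig : lebesgue_measure.-integrable `[-1, t + 1] (EFin \o g).
  by apply: continuous_compact_integrable;
    [exact: segment_compact|exact: continuous_subspaceT].
have [dg dgE] := continuous_FTC1_closed t1 ig N1t (cg t).
have d1 : is_derive t 1 (fun x => \int[lebesgue_measure]_(s in `[-1, x]) g s) (g t).
  by rewrite -dgE derive1E; exact: derivableP.
by rewrite -[g t]subr0; apply: is_deriveB.
Qed.

Lemma antiderivative0 g : antiderivative g 0 = 0.
Proof. by rewrite /antiderivative maxxx subrr. Qed.

Lemma antiderivative_has_derivative_in g t : continuous g -> 0 <= t ->
  has_derivative_in J (antiderivative g) t (g t).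
Proof.
move=> cg t0; apply: (eq_has_derivative_in t0 _ (is_derive_has_derivative_in (FTC cg t0))).
by move=> s s0; rewrite /antiderivative max_r.
Qed.

Lemma antiderivative_is_derive g t : continuous g -> 0 < t ->
  is_derive t 1 (antiderivative g) (g t).
Proof.
move=> cg t0; apply: has_derivative_in_is_derive => //.
by apply: antiderivative_has_derivative_in => //; exact: ltW.
Qed.

Lemma antiderivative_continuous g : continuous g -> continuous (antiderivative g).
Proof.
move=> cg t.
have c0 : 0 <= Num.max 0 t by rewrite le_max lexx.
have [/derivable1_diffP/differentiable_continuous C _] := FTC cg c0.
apply: (@continuous_comp _ _ _ (fun t : R => Num.max 0 t) (fun t =>
  \int[lebesgue_measure]_(s in `[-1, t]) g s -
  \int[lebesgue_measure]_(s in `[-1, 0]) g s)); last exact: C.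
exact: continuous_max0.
Qed.

(** Derivatives are compared through [barrier], so exponential majorants [B] enter by
    differentiation and never have to be integrated. *)
Lemma antiderivative_le g (B b : R -> R) (T t : R) : continuous g -> 0 <= B 0 -> continuous B ->
  (forall s : R, 0 < s -> is_derive s 1 B (b s)) ->
  (forall s, 0 < s -> s < T -> g s <= b s) ->
  0 <= t -> t <= T -> antiderivative g t <= B t.
Proof.
move=> cg B0 cB dB gb t0 tT; rewrite -subr_le0.
apply: (@barrier R (fun t => antiderivative g t - B t) (fun s => g s - b s) T) => //.
- move=> s; apply: cvgD; first exact: antiderivative_continuous.
  by apply: cvgN; exact: cB.
- by rewrite antiderivative0 sub0r oppr_le0.
- move=> s s0 sT _; apply: is_deriveB; last exact: dB.
  exact: antiderivative_is_derive.
- by move=> s s0 sT _; rewrite subr_le0 gb.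
Qed.

Lemma antiderivativeB g (h : R -> R) t : continuous g -> continuous h ->
  antiderivative g t - antiderivative h t = antiderivative (fun s => g s - h s) t.
Proof.
move=> cg ch.
have I (a b : R) k : continuous k -> lebesgue_measure.-integrable `[a, b] (EFin \o k).
  by move=> ck; apply: continuous_compact_integrable;
    [exact: segment_compact|exact: continuous_subspaceT].
rewrite /antiderivative !RintegralB//; try exact: I.
lra.
Qed.

End one_sided_derivatives.

(** * Lebesgue measure on R^n *)

Section lebesgue_rV_facts.
Context {R : realType}.

(** [A] is the union of those [B i] that lie inside it. With balls of rational centre and radius
    this makes open sets measurable for the sigma-algebra generated by the coordinates. *)
Lemma measurable_countable_cover d (T : measurableType d) (I : countType)
    (B : I -> set T) (A : set T) :
  (forall i, measurable (B i)) ->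
  (forall x, A x -> exists2 i, B i x & B i `<=` A) -> measurable A.
Proof.
move=> mB AB; pose C i := if `[< B i `<=` A >] then B i else set0.
have -> : A = \bigcup_i C i.
  apply/seteqP; split => [x /AB[i Bix BiA]|x [i _]].
    by exists i => //; rewrite /C asboolT.
  by rewrite /C; case: asboolP => // + ?; apply.
apply: countable_bigcupT_measurable => [|i]; first exact: countableP.
by rewrite /C; case: ifP.
Qed.

Definition rational_ball n (i : 'rV[rat]_n * nat) : set 'rV[R]_n :=
  ball (map_mx (@ratr R) i.1) i.2.+1%:R^-1.

Lemma measurable_rV_ball n (x : 'rV[R]_n) (r : R) : measurable (ball x r).
Proof.
(* For [r <= 0] the ball is empty, whereas in dimension 0 the intersection used below would be the
   whole space. *)
have [r0|r0] := ltP 0 r; last first.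
  suff -> : ball x r = set0 by [].
  by apply/seteqP; split => // y [] /lt_le_trans/(_ r0); rewrite ltxx.
have -> : ball x r = \bigcap_(i in [set: 'I_n])
    ((fun y : 'rV[R]_n => y ord0 i) @^-1` ball (x ord0 i) r).
  apply/seteqP; split => y.
    by move=> [_ yr] i _; exact: yr.
  by move=> yr; split => // i j; rewrite ord1; exact: yr.
apply: fin_bigcap_measurable; first exact: finite_finset.
move=> i _; rewrite -[X in measurable X]setTI.
by apply: measurable_rV_coord => //; exact: measurable_ball.
Qed.

(** A radius below [e / 2] and a rational centre within that radius of [x] suffice, by the triangle
    inequality. *)
Lemma rational_ball_basis n (x : 'rV[R]_n) (e : R) : 0 < e ->
  exists2 i, rational_ball i x & rational_ball i `<=` ball x e.
Proof.
move=> e0; have e2 : 0 < e / 2 by rewrite divr_gt0.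
have [k _ /(_ k (leqnn k)) /= ke] : \forall k \near \oo, (k.+1%:R^-1 : R) < e / 2.
  exact: near_infty_natSinv_lt (PosNum e2).
have k0 : 0 < (k.+1%:R^-1 : R) by rewrite invr_gt0.
have /choice[q qx] : forall i, exists q : rat,
    ratr q \in `]x ord0 i - k.+1%:R^-1, x ord0 i + k.+1%:R^-1[.
  by move=> i; apply: rat_in_itvoo; rewrite ltrD2l gtrN.
have bx : rational_ball (\row_i q i, k) x.
  split => // i j; rewrite ord1 !mxE /ball /= ltr_distl.
  by have := qx j; rewrite in_itv/=.
exists (\row_i q i, k) => // y yb.
have -> : e = e / 2 + e / 2 by field.
apply: (le_ball (lerD (ltW ke) (ltW ke))).
by apply: ball_triangle yb; exact: ball_sym.
Qed.

Lemma open_measurable_rV n (A : set 'rV[R]_n) : open A -> measurable A.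
Proof.
move=> oA; apply: (@measurable_countable_cover _ _ _ (@rational_ball n)).
  by move=> i; exact: measurable_rV_ball.
move=> x /oA /nbhs_ballP[e /= e0 eA].
have [i ix iA] := rational_ball_basis x e0.
by exists i => //; exact: subset_trans eA.
Qed.

Lemma open_measurable_rV2 n (A : set ('rV[R]_n * 'rV[R]_n)) :
  open A -> measurable A.
Proof.
move=> oA; apply: (@measurable_countable_cover _ _ _
    (fun i => rational_ball i.1 `*` @rational_ball n i.2)).
  by move=> i; apply: measurableX; exact: measurable_rV_ball.
move=> [x y] /oA /nbhs_ballP[e /= e0 eA].
have [i ix iA] := rational_ball_basis x e0.
have [j jy jA] := rational_ball_basis y e0.
by exists (i, j) => // -[x' y'] /= [/iA ? /jA ?]; exact: eA.
Qed.

Lemma continuous_measurable_rV n (g : 'rV[R]_n -> R) (D : set 'rV[R]_n) :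
  measurable D -> continuous g -> measurable_fun D g.
Proof.
move=> mD cg; apply: (@measurability _ _ _ _ _ _ (@RGenOpens.G R)).
  exact: RGenOpens.measurableE.
move=> _ [_ [a [b ->]] <-]; apply: measurableI => //.
by apply: open_measurable_rV; apply: open_comp => // x _; exact: cg.
Qed.

Lemma continuous_measurable_rV2 n (g : 'rV[R]_n * 'rV[R]_n -> R)
    (D : set ('rV[R]_n * 'rV[R]_n)) :
  measurable D -> continuous g -> measurable_fun D g.
Proof.
move=> mD cg; apply: (@measurability _ _ _ _ _ _ (@RGenOpens.G R)).
  exact: RGenOpens.measurableE.
move=> _ [_ [a [b ->]] <-]; apply: measurableI => //.
by apply: open_measurable_rV2; apply: open_comp => // x _; exact: cg.
Qed.

Definition rV_box n (r : R) : set 'rV[R]_n :=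
  [set x | forall i, x ord0 i \in `[- r, r]].

Lemma measurable_rV_box n (r : R) : measurable (@rV_box n r).
Proof.
have -> : @rV_box n r = \bigcap_(i in [set: 'I_n])
    ((fun y : 'rV[R]_n => y ord0 i) @^-1` `[- r, r]%classic).
  by apply/seteqP; split => y; [move=> yr i _; exact: yr|move=> yr i; exact: yr].
apply: fin_bigcap_measurable; first exact: finite_finset.
move=> i _; rewrite -[X in measurable X]setTI.
by apply: measurable_rV_coord => //; exact: measurable_itv.
Qed.

(** Under [rV_cons] a box of dimension n+1 becomes an interval times a box of dimension n, so the
    measure is finite by induction. *)
Lemma lebesgue_rV_box n (r : R) : (lebesgue_rV R n (@rV_box n r) < +oo)%E.
Proof.
elim: n => [|n IH] /=.
  by rewrite diracE; case: (_ \in _); rewrite ltry.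
rewrite /lebesgue_rV_succ /pushforward.
have -> : @rV_cons R n @^-1` (@rV_box n.+1 r) = `[- r, r]%classic `*` @rV_box n r.
  apply/seteqP; split => [[x y] /= H|[x y] /= [H1 H2] i].
    split; first by have := H ord0; rewrite rV_cons0.
    by move=> i; have := H (lift ord0 i); rewrite rV_consS.
  by case: (unliftP ord0 i) => [j|] ->; rewrite ?rV_consS ?rV_cons0//; exact: H2.
rewrite product_measure1E//; last exact: measurable_rV_box.
rewrite lte_mul_pinfty//.
have E := @lebesgue_measure_itv R `[- r, r].
by apply: (eq_ind_r (fun z => z \is a fin_num) _ E); case: ifP.
Qed.

Lemma bounded_lebesgue_rV n (A : set 'rV[R]_n) : measurable A ->
  bounded_set A -> (lebesgue_rV R n A < +oo)%E.
Proof.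
move=> mA [M [_ AM]].
apply: le_lt_trans (lebesgue_rV_box n (M + 1)).
apply: le_measure; rewrite ?inE//; first exact: measurable_rV_box.
move=> x /(AM (M + 1) ltac:(rewrite ltrDl//)) /= xM i.
rewrite in_itv/= -ler_norml; apply: le_trans xM.
rewrite [leRHS]/Num.norm/= mx_normrE.
by apply: (le_bigmax _ (fun ij => `|x ij.1 ij.2|) (ord0, i)).
Qed.

End lebesgue_rV_facts.

(** * Integration of continuous functions over a bounded open set *)

Section compactness.
Context {R : realType}.

Lemma compact_norm_bounded (T : topologicalType) (W : normedModType R)
    (A : set T) (g : T -> W) :
  compact A -> {within A, continuous g} ->
  exists M, 0 <= M /\ forall x, A x -> `|g x| <= M.
Proof.
move=> cA cg; have [M [_ HM]] := compact_bounded (continuous_compact cg cA).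
exists (`|M| + 1); split => [|x Ax]; first by rewrite addr_ge0.
apply: HM; last by exists x.
by rewrite (le_lt_trans (ler_norm M))// ltrDl.
Qed.

(** A tube-lemma argument: compactness of [A] turns continuity at each point [(z, y)] into one
    neighbourhood of [z] that serves all [y] in [A]. *)
Lemma compact_uniform_near (T S : topologicalType) (A : set S)
    (h : T * S -> R) (z : T) (e : R) :
  compact A -> continuous h -> 0 < e ->
  \forall z' \near z, forall y, A y -> `|h (z', y) - h (z, y)| <= e.
Proof.
move=> /compact_near_coveringP cA ch e0.
apply: (cA _ (nbhs z) (fun z' y => `|h (z', y) - h (z, y)| <= e)) => y Ay.
have e2 : 0 < e / 2 by rewrite divr_gt0.
have /cvgrPdist_lt/(_ _ e2) [[U1 U2]/= [HU1 HU2] HU] := ch (z, y).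
exists (U2, U1) => // -[y' z'] [/= U2y U1z].
have H1 := HU (z', y') (conj U1z U2y).
have H2 := HU (z, y') (conj (nbhs_singleton HU1) U2y).
rewrite /= in H1 H2 *.
rewrite -(subrKA (h (z, y))) (le_trans (ler_normD _ _))//.
rewrite (_ : e = e / 2 + e / 2); last by field.
by apply: lerD; apply: ltW => //; rewrite distrC.
Qed.

Lemma closure_bounded_compact n (A : set 'rV[R]_n) :
  bounded_set A -> compact (closure A).
Proof.
move=> [M [_ AM]]; apply: bounded_closed_compact; last exact: closed_closure.
exists (M + 1); split; first exact: num_real.
move=> N MN x; have cl : closed [set x : 'rV[R]_n | `|x| <= M + 1].
  apply: (@closed_comp _ _ (fun x : 'rV[R]_n => `|x|) [set r | r <= M + 1]) => //.
    by move=> y _; exact: norm_continuous.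
have sub : A `<=` [set x | `|x| <= M + 1].
  by move=> y Ay /=; apply: AM => //; rewrite ltrDl.
move=> /(closureS sub); rewrite -(proj1 (closure_id _) cl) /= => /le_trans.
by apply; exact: ltW.
Qed.

End compactness.

Section integral_over_bounded_domain.
Context {R : realType} {n : nat}.
Variable Omega : set 'rV[R]_n.
Hypothesis oOmega : open Omega.
Hypothesis bOmega : bounded_set Omega.
Let leb := lebesgue_rV R n.
Let vol := fine (leb Omega).
Implicit Types g h : 'rV[R]_n -> R.

Let mOmega : measurable Omega. Proof. exact: open_measurable_rV. Qed.

Let finOmega : (leb Omega < +oo)%E. Proof. exact: bounded_lebesgue_rV. Qed.

Let cOmega : compact (closure Omega). Proof. exact: closure_bounded_compact. Qed.

Lemma continuous_integrable g : continuous g ->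
  leb.-integrable Omega (EFin \o g).
Proof.
move=> cg; apply: measurable_bounded_integrable => //.
  exact: continuous_measurable_rV.
have [M [M0 HM]] := compact_norm_bounded cOmega (continuous_subspaceT cg).
exists M; split; first exact: num_real.
move=> N MN x Ox; apply: (le_trans (HM _ _)); last exact: ltW.
exact: subset_closure.
Qed.

Lemma vol_ge0 : 0 <= vol. Proof. exact: fine_ge0. Qed.

Lemma integral_le_bound g M : continuous g -> (forall y, Omega y -> g y <= M) ->
  \int[leb]_(y in Omega) g y <= M * vol.
Proof.
move=> cg gM; rewrite -Rintegral_cst//; apply: le_Rintegral => //.
  exact: continuous_integrable.
exact: (continuous_integrable (@continuous_cst _ _ M)).
Qed.

Lemma norm_integral_le_bound g M : continuous g ->
  (forall y, Omega y -> `|g y| <= M) ->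
  `|\int[leb]_(y in Omega) g y| <= M * vol.
Proof.
move=> cg gM; apply: le_trans (le_normr_Rintegral mOmega _) _.
  exact: continuous_integrable.
by apply: integral_le_bound => //; exact: continuous_norm.
Qed.

Lemma continuous_parameter_integral (T : topologicalType)
    (h : T * 'rV[R]_n -> R) : continuous h ->
  continuous (fun z => \int[leb]_(y in Omega) h (z, y)).
Proof.
move=> ch z; apply/cvgrPdist_le => e e0.
have v1 : 0 < vol + 1 by rewrite ltr_wpDl// vol_ge0.
have chz z' : continuous (fun y => h (z', y)).
  by apply: continuous_compose ch; apply: continuous_pair;
    [exact: continuous_cst|exact: continuous_id].
near=> z'.
rewrite -RintegralB//; [|exact: continuous_integrable..].
(* Dividing by [vol + 1] avoids a separate case for [vol = 0]. *)
apply: le_trans (norm_integral_le_bound (M := e / (vol + 1)) _ _) _.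
- by apply: continuous_sub; exact: chz.
- move=> y Oy; rewrite distrC; move: y Oy.
  near: z'.
  have := @compact_uniform_near _ _ _ _ h z (e / (vol + 1)) cOmega ch.
  rewrite divr_gt0// => /(_ isT); apply: filterS => z' H y Oy.
  by apply: H; exact: subset_closure.
- by rewrite mulrAC ler_pdivrMr// ler_wpM2l ?ltW// ltrDl.
Unshelve. all: by end_near. Qed.

Lemma integral_weighted_sum k (a : 'I_k -> R) (F : 'I_k -> 'rV[R]_n -> R) :
  (forall i, continuous (F i)) ->
  \int[leb]_(y in Omega) (\sum_i a i * F i y) =
  \sum_i a i * \int[leb]_(y in Omega) F i y.
Proof.
elim: k a F => [|k IH] a F cF.
  under eq_Rintegral do rewrite big_ord0.
  by rewrite big_ord0 Rintegral_cst// mul0r.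
under eq_Rintegral do rewrite big_ord_recl.
have caF i : continuous (fun y => a i * F i y).
  by apply: continuous_mul => //; exact: continuous_cst.
rewrite RintegralD//.
- by rewrite big_ord_recl IH// RintegralZl//; exact: continuous_integrable.
- exact: continuous_integrable.
- by apply: continuous_integrable; exact: continuous_sum.
Qed.

(** Exchanging the order of integration turns the double integral into its own negative. This is
    what cancels the diffusion in the total mass. *)
Lemma antisymmetric_integral (h : 'rV[R]_n * 'rV[R]_n -> R) : continuous h ->
  (forall x y, Omega x -> Omega y -> h (x, y) = - h (y, x)) ->
  \int[leb]_(x in Omega) \int[leb]_(y in Omega) h (x, y) = 0.
Proof.
move=> ch hN.
(* Antisymmetry holds only on [Omega], and Fubini is applied on the whole space, so [h] is cut off
   by zero outside [Omega * Omega]. *)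
pose k := ((EFin \o h) \_ (Omega `*` Omega))%E.
have mO2 : measurable (Omega `*` Omega) by exact: measurableX.
have ik : (leb \x leb)%E.-integrable setT k.
  apply/(integrable_mkcond _ mO2); apply: measurable_bounded_integrable => //.
  - have := product_measure1E leb leb mOmega mOmega => /= ->.
    by apply: lte_mul_pinfty => //; rewrite ge0_fin_numE.
  - exact: continuous_measurable_rV2.
  - have [M [M0 HM]] := compact_norm_bounded (compact_setX cOmega cOmega)
      (continuous_subspaceT ch).
    exists M; split; first exact: num_real.
    move=> N MN [x y] [Ox Oy]; apply: (le_trans (HM _ _)); last exact: ltW.
    by split; exact: subset_closure.
have chz z' : continuous (fun y => h (z', y)).
  by apply: continuous_compose ch; apply: continuous_pair;
    [exact: continuous_cst|exact: continuous_id].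
have k12 x y : k (x, y) = if (x \in Omega) && (y \in Omega) then (h (x, y))%:E else 0%E.
  by rewrite /k patchE in_setX.
have E x : (\int[leb]_y k (x, y))%E =
    (((fun x => (\int[leb]_(y in Omega) h (x, y))%R%:E) \_ Omega) x)%E.
  rewrite patchE; case: ifPn => Ox.
    rewrite -[RHS]/((fine _)%:E) fineK; last first.
      by apply: integrable_fin_num => //; exact: continuous_integrable.
    rewrite [RHS]integral_mkcond; apply: eq_integral => y _.
    by rewrite k12 Ox patchE.
  by rewrite integral0_eq// => y _; rewrite k12 (negbTE Ox).
(* Antisymmetry is used here: integrating out the first variable gives the same inner integral with
   the opposite sign. *)
have E' y : (\int[leb]_x k (x, y))%E =
    (((fun x => (\int[leb]_(y in Omega) (- h (x, y)))%R%:E) \_ Omega) y)%E.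
  rewrite patchE; case: ifPn => Oy.
    rewrite -[RHS]/((fine _)%:E) fineK; last first.
      apply: integrable_fin_num => //; apply: continuous_integrable.
      exact: continuous_opp.
    rewrite [RHS]integral_mkcond; apply: eq_integral => x _.
    rewrite k12 Oy patchE andbT; case: ifPn => // Ox.
    by rewrite hN ?inE//; exact: set_mem.
  by rewrite integral0_eq// => x _; rewrite k12 (negbTE Oy) andbF.
have cI : continuous (fun x => \int[leb]_(y in Omega) h (x, y)).
  exact: continuous_parameter_integral.
have := Fubini ik.
under eq_integral do rewrite E.
under [RHS]eq_integral do rewrite E'.
rewrite -!integral_mkcond => H.
have {H} : \int[leb]_(x in Omega) \int[leb]_(y in Omega) h (x, y) =
    \int[leb]_(x in Omega) (- 1 * \int[leb]_(y in Omega) h (x, y)).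
  rewrite {1}/Rintegral H; congr fine; apply: eq_integral => x _.
  rewrite -RintegralZl//; last exact: continuous_integrable.
  by congr (_%:E); apply: eq_Rintegral => y _; rewrite mulN1r.
rewrite RintegralZl//; last exact: continuous_integrable.
lra.
Qed.

(** Differentiation under the integral sign. The dominating function is a constant, the bound of [g]
    on the compact set formed by [[0, t0 + 1]] and the closure of [Omega]. *)
Lemma is_derive_integral (w g : 'rV[R]_n -> R -> R) (t0 : R) :
  (forall t, continuous (w ^~ t)) ->
  continuous (fun p : R * 'rV[R]_n => g p.2 p.1) -> 
  (forall x (t : R), 0 < t -> is_derive t 1 (w x) (g x t)) -> 0 < t0 ->
  is_derive t0 1 (fun t => \int[leb]_(x in Omega) w x t)
    (\int[leb]_(x in Omega) g x t0).
Proof.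
move=> cw cg dw t00.
have I0 : (`]0, t0 + 1[%classic : set R) t0.
  by rewrite /= in_itv/= t00 ltrDl ltr01.
have [M [M0 HM]] := compact_norm_bounded
  (compact_setX (@segment_compact R 0 (t0 + 1)) cOmega) (continuous_subspaceT cg).
have intf t : (`]0, t0 + 1[%classic : set R) t ->
    leb.-integrable Omega (EFin \o (w^~ t)).
  by move=> _; exact: continuous_integrable.
have der t x : (`]0, t0 + 1[%classic : set R) t -> Omega x -> derivable (w x) t 1.
  by rewrite /= in_itv/= => /andP[t_0 _] _; have [] := dw x t t_0.
have iM : leb.-integrable Omega (EFin \o (fun=> M)).
  exact: (continuous_integrable (@continuous_cst _ _ M)).
have ub t x : (`]0, t0 + 1[%classic : set R) t -> Omega x ->
    `|partial1of2 (fun t x => w x t) t x| <= M.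
  rewrite /= in_itv/= => /andP[t_0 t_1] Ox; rewrite partial1of2E.
  have [_ ->] := dw x t t_0.
  apply: (HM (t, x)); split => /=; last exact: subset_closure.
  by rewrite in_itv/= !ltW.
have E : \int[leb]_(x in Omega) g x t0 =
    \int[leb]_(x in Omega) partial1of2 (fun t x => w x t) t0 x.
  apply: eq_Rintegral => x _; rewrite partial1of2E.
  by have [_ ->] := dw x t0 t00.
split.
  exact: (@derivable_under_integral _ _ _ leb (fun t x => w x t) Omega mOmega
    t0 0 (t0 + 1) I0 intf der (fun=> M) (fun=> M0) iM ub).
rewrite E -derive1E.
exact: (@differentiation_under_integral _ _ _ leb (fun t x => w x t) Omega mOmega
    t0 0 (t0 + 1) I0 intf der (fun=> M) (fun=> M0) iM ub).
Qed.

End integral_over_bounded_domain.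

(** * Picard iteration *)

Section antiderivatives_with_parameter.
Context {R : realType}.

Lemma is_derive_scaled_exp (c k t : R) :
  is_derive t 1 (fun s => c * expR (k * s)) (c * k * expR (k * t)).
Proof.
have d1 : is_derive t 1 (fun s : R => k * s) k.
  have := is_deriveZ k (is_derive_id t (1 : R)).
  by rewrite /GRing.scale/= mulr1.
have d2 : is_derive t 1 (expR \o (fun s : R => k * s)) (expR (k * t) * k).
  exact: is_derive1_comp.
have := is_deriveZ c d2.
by rewrite /GRing.scale/= mulrA mulrAC.
Qed.

Lemma continuous_scaled_exp (c k : R) : continuous (fun s => c * expR (k * s)).
Proof.
move=> t; have [/derivable1_diffP/differentiable_continuous C _] :=
  is_derive_scaled_exp c k t.
exact: C.
Qed.

Lemma antiderivativeN (g : R -> R) t : continuous g ->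
  antiderivative (fun s => - g s) t = - antiderivative g t.
Proof.
move=> cg; have E0 : antiderivative (fun s => g s - g s) t = 0.
  by rewrite -antiderivativeB// subrr.
have c0 : continuous (fun s => g s - g s) by exact: continuous_sub.
rewrite -[RHS]add0r -E0 antiderivativeB//; congr (antiderivative _ t).
by apply/funext => s; rewrite subrr add0r.
Qed.

Lemma antiderivative_norm_le (g B b : R -> R) (T t : R) :
  continuous g -> 0 <= B 0 -> continuous B ->
  (forall s : R, 0 < s -> is_derive s 1 B (b s)) ->
  (forall s, 0 < s -> s < T -> `|g s| <= b s) ->
  0 <= t -> t <= T -> `|antiderivative g t| <= B t.
Proof.
move=> cg B0 cB dB gb t0 tT; rewrite ler_norml; apply/andP; split.
  rewrite lerNl -antiderivativeN//.
  apply: (antiderivative_le (b := b) (T := T)) => //; first exact: continuous_opp.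
  by move=> s s0 sT; rewrite (le_trans _ (gb s s0 sT))// -normrN ler_norm.
apply: (antiderivative_le (b := b) (T := T)) => //.
by move=> s s0 sT; rewrite (le_trans _ (gb s s0 sT))// ler_norm.
Qed.

Lemma antiderivative_norm_le_cst (g : R -> R) (c T t : R) :
  continuous g -> (forall s, 0 < s -> s < T -> `|g s| <= c) ->
  0 <= t -> t <= T -> `|antiderivative g t| <= c * t.
Proof.
move=> cg gc t0 tT.
apply: (antiderivative_norm_le (B := fun t => c * t) (b := fun=> c) (T := T)) => //.
- by rewrite mulr0.
- by apply: continuous_mul; [exact: continuous_cst|exact: continuous_id].
- move=> s _; have := is_deriveZ c (is_derive_id s (1 : R)).
  by rewrite /GRing.scale/= mulr1.
Qed.

Lemma antiderivative_max0 (g : R -> R) t :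
  antiderivative g (Num.max 0 t) = antiderivative g t.
Proof. by rewrite /antiderivative maxA maxxx. Qed.

(** Moving [t] at fixed [x0] costs [e / 2] by continuity of one antiderivative. Moving [x] changes
    the integrand uniformly on [[0, T]] by at most [e / 2 / T], which integrates to the other
    half. *)
Lemma antiderivative_joint_continuous (V : topologicalType) (h : V * R -> R) :
  continuous h ->
  continuous (fun p : V * R => antiderivative (fun s => h (p.1, s)) p.2).
Proof.
move=> ch [x0 t0] /=; apply/cvgrPdist_le => e e0.
have chx x : continuous (fun s => h (x, s)).
  apply: continuous_compose ch; apply: continuous_pair.
    exact: continuous_cst.
  exact: continuous_id.
(* The extra 1 leaves room for all [t] near [t0]. *)
set T := Num.max 0 t0 + 1.
have T0 : 0 < T by rewrite ltr_wpDl// le_max lexx.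
have e2 : 0 < e / 2 by rewrite divr_gt0.
have c0 : 0 < e / 2 / T by rewrite divr_gt0.
have Hx := @compact_uniform_near _ _ _ _ h x0 _ (@segment_compact R 0 T) ch c0.
have Ht : \forall t \near t0, t <= T /\
    `|antiderivative (fun s => h (x0, s)) t0 - antiderivative (fun s => h (x0, s)) t| <= e / 2.
  apply: filterI.
    apply: (cvgr_le t0 (@continuous_id R t0)).
    by rewrite /T (@le_lt_trans _ _ (Num.max 0 t0))// ?ltrDl// le_max lexx orbT.
  have /cvgrPdist_le := @antiderivative_continuous _ _ (chx x0) t0.
  exact.
exists ([set x | forall y, `[0, T]%classic y -> `|h (x, y) - h (x0, y)| <= e / 2 / T],
  [set t | t <= T /\
    `|antiderivative (fun s => h (x0, s)) t0 - antiderivative (fun s => h (x0, s)) t| <= e / 2]) => //.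
move=> [x t] /= [Hxy [tT H]].
rewrite -(subrKA (antiderivative (fun s => h (x0, s)) t)).
rewrite (le_trans (ler_normD _ _))// [leRHS]splitr lerD//.
rewrite antiderivativeB// -antiderivative_max0.
have m0 : 0 <= Num.max 0 t by rewrite le_max lexx.
have mT : Num.max 0 t <= T by rewrite ge_max (ltW T0) tT.
apply: le_trans (antiderivative_norm_le_cst (c := e / 2 / T) (T := T) _ _ m0 mT) _.
- exact: continuous_sub.
- by move=> s s0 sT; rewrite distrC; apply: Hxy; rewrite /= in_itv/= !ltW.
- by rewrite mulrAC ler_pdivrMr// ler_wpM2l// ltW.
Qed.

End antiderivatives_with_parameter.

Definition jointly_continuous {R : realType} {V : topologicalType} {m : nat}
  (u : V -> R -> 'rV[R]_m) := continuous (fun p : V * R => u p.1 p.2).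

(** * The Cauchy problem for curves of continuous functions *)

Section picard.
Context {R : realType} {V : topologicalType} {m : nat}.
Variables (G : R -> (V -> 'rV[R]_m) -> V -> 'rV[R]_m) (v : V -> 'rV[R]_m).
Implicit Types (u : V -> R -> 'rV[R]_m) (w : V -> 'rV[R]_m) (t T : R).

Hypothesis continuousG : forall u, jointly_continuous u ->
  jointly_continuous (fun x t => G t (u ^~ t) x).
Hypothesis lipschitzG : forall T, exists2 Lam, 0 <= Lam &
  forall t w w' B, 0 <= t -> t <= T -> continuous w -> continuous w' -> 0 <= B ->
    (forall x, `|w x - w' x| <= B) ->
    forall x, `|G t w x - G t w' x| <= Lam * B.
Hypothesis continuous_v : continuous v.
(** [V] need not be compact, so a uniform bound on the first Picard increment has to be supplied; it
    is the constant that starts the geometric decay. *)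
Hypothesis boundedGv : forall T, exists2 D, 0 <= D &
  forall t x, 0 <= t -> t <= T -> `|G t v x| <= D.

(** Freezing time at 0 for negative [s] makes the integrand continuous on the whole line, as the
    facts on [antiderivative] require. *)
Let rhs u x i (s : R) : R := G (Num.max 0 s) (u ^~ (Num.max 0 s)) x ord0 i.

Definition picard_step u : V -> R -> 'rV[R]_m := fun x t =>
  \row_i (v x ord0 i + antiderivative (rhs u x i) t).

Let rhs_joint u i : jointly_continuous u ->
  continuous (fun p : V * R => rhs u p.1 i p.2).
Proof.
move=> /continuousG cu; apply: continuous_rV_coord.
apply: (@continuous_compose _ _ _ (fun p : V * R => (p.1, Num.max 0 p.2)) _ _ cu).
apply: continuous_pair; first exact: continuous_fst.
by apply: continuous_compose continuous_max0; exact: continuous_snd.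
Qed.

Let rhs_continuous u x i : jointly_continuous u -> continuous (rhs u x i).
Proof.
move=> cu; have H := @rhs_joint u i cu.
apply: (@continuous_compose _ _ _ (fun s => (x, s)) _ _ H).
by apply: continuous_pair; [exact: continuous_cst|exact: continuous_id].
Qed.

Lemma picard_step_continuous u : jointly_continuous u ->
  jointly_continuous (picard_step u).
Proof.
move=> cu; apply: continuous_rV => i; rewrite /picard_step.
under eq_fun do rewrite mxE.
apply: continuous_add.
  apply: continuous_rV_coord.
  by apply: continuous_compose continuous_v; exact: continuous_fst.
exact: (antiderivative_joint_continuous (@rhs_joint u i cu)).
Qed.

Lemma jointly_continuous_slice u t : jointly_continuous u -> continuous (u ^~ t).
Proof.
move=> cu; apply: (@continuous_compose _ _ _ (fun x => (x, t)) _ _ cu).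
by apply: continuous_pair; [exact: continuous_id|exact: continuous_cst].
Qed.

(** The integral of [Lam * C * expR (2 * Lam * s)] from 0 to [t] is at most
    [C / 2 * expR (2 * Lam * t)]: the doubled exponent is what produces the factor 1/2. *)
Lemma picard_step_contraction T Lam C u u' : 0 <= C -> 0 <= Lam ->
  (forall t w w' B, 0 <= t -> t <= T -> continuous w -> continuous w' -> 0 <= B ->
    (forall x, `|w x - w' x| <= B) ->
    forall x, `|G t w x - G t w' x| <= Lam * B) ->
  jointly_continuous u -> jointly_continuous u' ->
  (forall x t, 0 <= t -> t <= T -> `|u x t - u' x t| <= C * expR (2 * Lam * t)) ->
  forall x t, 0 <= t -> t <= T ->
    `|picard_step u x t - picard_step u' x t| <= C / 2 * expR (2 * Lam * t).
Proof.
move=> C0 Lam0 lip cu cu' uu' x t t0 tT.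
apply: rV_norm_le => [|i]; first by rewrite mulr_ge0 ?divr_ge0 ?expR_ge0.
rewrite !mxE opprD addrACA subrr add0r antiderivativeB; try exact: rhs_continuous.
apply: (antiderivative_norm_le (B := fun s => C / 2 * expR (2 * Lam * s))
  (b := fun s => C / 2 * (2 * Lam) * expR (2 * Lam * s)) (T := T)) => //.
- by apply: continuous_sub; exact: rhs_continuous.
- by rewrite mulr_ge0 ?divr_ge0 ?expR_ge0.
- exact: continuous_scaled_exp.
- by move=> s s0; exact: is_derive_scaled_exp.
- move=> s s0 sT; rewrite /rhs (max_r (ltW s0)).
  have := le_coord_rV_norm (G s (u ^~ s) x - G s (u' ^~ s) x) i.
  rewrite !mxE => /le_trans; apply.
  have -> : C / 2 * (2 * Lam) * expR (2 * Lam * s) = Lam * (C * expR (2 * Lam * s)).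
    by field.
  apply: lip => //; try exact: ltW; try exact: jointly_continuous_slice.
    by rewrite mulr_ge0 ?expR_ge0.
  by move=> y; apply: uu'; exact: ltW.
Qed.

Fixpoint picard_iter k : V -> R -> 'rV[R]_m :=
  if k is k'.+1 then picard_step (picard_iter k') else fun x _ => v x.

Lemma picard_iter_continuous k : jointly_continuous (picard_iter k).
Proof.
elim: k => [|k IH] /=; last exact: picard_step_continuous.
by apply: continuous_compose continuous_v; exact: continuous_fst.
Qed.

Lemma picard_iter_diff T : exists D Lam, [/\ 0 <= D, 0 <= Lam,
  forall t w w' B, 0 <= t -> t <= T -> continuous w -> continuous w' -> 0 <= B ->
    (forall x, `|w x - w' x| <= B) ->
    forall x, `|G t w x - G t w' x| <= Lam * B &
  forall k x t, 0 <= t -> t <= T ->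
    `|picard_iter k.+1 x t - picard_iter k x t| <=
      D / 2 ^+ k * expR (2 * Lam * t)].
Proof.
have [Lam Lam0 lip] := lipschitzG T.
have [D D0 HD] := boundedGv T.
(* The first increment is an integral over a time at most [T]; the absolute value covers a negative
   [T], for which the bound is vacuous but the constant must still be nonnegative. *)
exists (D * `|T|), Lam; split => //; first by rewrite mulr_ge0.
elim=> [|k IH] x t t0 tT; last first.
  have -> : D * `|T| / 2 ^+ k.+1 = D * `|T| / 2 ^+ k / 2.
    by rewrite exprS invfM mulrA mulrAC.
  apply: (@picard_step_contraction T) => //.
  - by rewrite divr_ge0 ?mulr_ge0 ?exprn_ge0.
  - by apply: picard_step_continuous; exact: picard_iter_continuous.
  - exact: picard_iter_continuous.
rewrite expr0 divr1 /=.
apply: rV_norm_le => [|i]; first by rewrite !mulr_ge0 ?expR_ge0.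
rewrite !mxE addrAC subrr add0r.
apply: le_trans (antiderivative_norm_le_cst (c := D) (T := T) _ _ t0 tT) _.
- apply: rhs_continuous; exact: (@picard_iter_continuous 0).
- move=> s s0 sT; rewrite /rhs (max_r (ltW s0)).
  apply: le_trans (le_coord_rV_norm _ _) _.
  by apply: HD; exact: ltW.
- apply: (@le_trans _ _ (D * `|T|)).
    by rewrite ler_wpM2l// (le_trans tT)// ler_norm.
  rewrite ler_peMr ?mulr_ge0// -expR0 ler_expR.
  by rewrite !mulr_ge0.
Qed.

(** The limit is chosen pointwise and coordinatewise. The explicit rate then shows that convergence
    is uniform in x and locally uniform in t, so the limit is continuous and fixed by [picard_step].
    The last clause provides the a priori bound that [halving] asks for. *)
Theorem picard_existence : exists u,
  [/\ jointly_continuous u,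
      forall x, u x 0 = v x,
      forall x t i, 0 <= t ->
        has_derivative_in (time_interval (+oo%E : \bar R))
          (fun s => u x s ord0 i) t (G t (u ^~ t) x ord0 i) &
      forall T, exists B, forall x t, 0 <= t -> t <= T -> `|u x t - v x| <= B].
Proof.
have m0 t : 0 <= Num.max 0 t by rewrite le_max lexx.
have diff_coord T D Lam (HD : forall k x t, 0 <= t -> t <= T ->
    `|picard_iter k.+1 x t - picard_iter k x t| <=
      D / 2 ^+ k * expR (2 * Lam * t)) x t i k : 0 <= t -> t <= T ->
    `|picard_iter k.+1 x t ord0 i - picard_iter k x t ord0 i| <=
      D * expR (2 * Lam * t) / 2 ^+ k.
  move=> t0 tT; have := le_coord_rV_norm (picard_iter k.+1 x t - picard_iter k x t) i.
  rewrite [X in `|X| <= _]mxE [X in _ + X]mxE => /le_trans; apply.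
  by rewrite mulrAC; exact: HD.
(* The constant [C] may depend on the point here; [rate] below recovers a uniform one through
   [geometric_limit_rate]. *)
have /choice[l Hl] : forall z : V * R * 'I_m, exists l, exists C, forall k,
    `|picard_iter k z.1.1 (Num.max 0 z.1.2) ord0 z.2 - l| <= C / 2 ^+ k.
  move=> [[x t] i] /=.
  have [D [Lam [D0 _ _ /diff_coord HD]]] := picard_iter_diff (Num.max 0 t).
  have CD : 0 <= D * expR (2 * Lam * Num.max 0 t) by rewrite mulr_ge0 ?expR_ge0.
  have [l Hl] := geometric_limit CD (fun k => HD x _ i k (m0 t) (lexx _)).
  by exists l; exists (2 * (D * expR (2 * Lam * Num.max 0 t))).
pose u x t : 'rV[R]_m := \row_i l ((x, t), i).
(* Both sides are limits of the same sequence, since the chosen limits look only at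
   [Num.max 0 t]. *)
have um x t : u x (Num.max 0 t) = u x t.
  apply/rowP => i; rewrite !mxE.
  have [C HC] := Hl ((x, t), i); have [C' HC'] := Hl ((x, Num.max 0 t), i).
  move: HC HC' => /= HC; rewrite maxA maxxx => HC'.
  apply/eqP; rewrite -subr_eq0 -normr_le0.
  apply: (@geometric_le0 _ _ (C' + C)) => k.
  rewrite -(subrKA (picard_iter k x (Num.max 0 t) ord0 i)).
  rewrite (le_trans (ler_normD _ _))// mulrDl lerD//.
  by rewrite distrC.
have rate T D Lam (D0 : 0 <= D) (HD : forall k x t, 0 <= t -> t <= T ->
    `|picard_iter k.+1 x t - picard_iter k x t| <=
      D / 2 ^+ k * expR (2 * Lam * t)) x t k : 0 <= t -> t <= T ->
    `|picard_iter k x t - u x t| <= 2 * D / 2 ^+ k * expR (2 * Lam * t).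
  move=> t0 tT; apply: rV_norm_le => [|i].
    by rewrite !mulr_ge0 ?invr_ge0 ?exprn_ge0 ?expR_ge0.
  have [C /= HC] := Hl ((x, t), i); rewrite (max_r t0) in HC.
  have CD : 0 <= D * expR (2 * Lam * t) by rewrite mulr_ge0 ?expR_ge0.
  rewrite !mxE [leRHS]mulrAC -(mulrA 2 D).
  exact: (geometric_limit_rate CD (fun k => diff_coord _ _ _ HD x t i k t0 tT) HC).
(* Three thirds of [e]: two for the distance to a fixed iterate, uniform up to time [T], and one for
   the continuity of that iterate. *)
have cu : jointly_continuous u.
  move=> [x0 t0]; apply/cvgrPdist_le => e e0.
  set T := Num.max 0 t0 + 1.
  have t0T : Num.max 0 t0 <= T by rewrite lerDl.
  have [D [Lam [D0 Lam0 _ HD]]] := picard_iter_diff T.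
  have e3 : 0 < e / 3 by rewrite divr_gt0.
  have [k Hk] := geometric_small (2 * D * expR (2 * Lam * T)) e3.
  have Hu x t : t <= T -> `|picard_iter k x (Num.max 0 t) - u x t| <= e / 3.
    move=> tT; rewrite -um; apply: le_trans (rate _ _ _ D0 HD _ _ _ (m0 t) _) _.
      by rewrite ge_max tT (le_trans (m0 t0)).
    apply: le_trans Hk; rewrite [leRHS]mulrAC ler_wpM2l//.
      by rewrite !mulr_ge0 ?invr_ge0 ?exprn_ge0.
    rewrite ler_expR ler_wpM2l ?mulr_ge0//.
    by rewrite ge_max tT (le_trans (m0 t0)).
  have ck : continuous (fun p : V * R => picard_iter k p.1 (Num.max 0 p.2)).
    apply: (@continuous_compose _ _ _ (fun p : V * R => (p.1, Num.max 0 p.2)) _ _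
      (@picard_iter_continuous k)).
    apply: continuous_pair; first exact: continuous_fst.
    by apply: continuous_compose continuous_max0; exact: continuous_snd.
  have near_t : \forall p \near (x0, t0), p.2 <= T.
    apply: (cvgr_le t0 (@continuous_snd V R (x0, t0))).
    by rewrite (@le_lt_trans _ _ (Num.max 0 t0))// ?ltrDl// le_max lexx orbT.
  have /cvgrPdist_le/(_ _ e3) := ck (x0, t0).
  apply: filterS2 near_t => -[x t] /= tT Hxt.
  have -> : e = e / 3 + e / 3 + e / 3 by field.
  rewrite -(subrKA (picard_iter k x (Num.max 0 t))) (le_trans (ler_normD _ _))//.
  apply: lerD; last exact: Hu.
  rewrite -(subrKA (picard_iter k x0 (Num.max 0 t0))) (le_trans (ler_normD _ _))//.
  apply: lerD => //; rewrite distrC; apply: Hu.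
  by apply: le_trans t0T; rewrite le_max lexx orbT.
have ustep x t : u x t = picard_step u x t.
  suff H s : 0 <= s -> u x s = picard_step u x s.
    rewrite -um H//; apply/rowP => i; rewrite !mxE; congr (_ + _).
    exact: antiderivative_max0.
  move=> s0; have [D [Lam [D0 Lam0 lip HD]]] := picard_iter_diff s.
  apply/eqP; rewrite -subr_eq0 -normr_le0.
  apply: (@geometric_le0 _ _ (2 * D * expR (2 * Lam * s))) => k.
  rewrite -(subrKA (picard_iter k.+1 x s)) (le_trans (ler_normD _ _))//.
  (* The first summand is the distance from [u] to iterate k+1. The second is the distance from that
     iterate to [picard_step u], namely the contracted distance between iterate k and [u]. *)
  have -> : 2 * D * expR (2 * Lam * s) / 2 ^+ k =
      2 * D / 2 ^+ k.+1 * expR (2 * Lam * s) +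
      2 * D / 2 ^+ k / 2 * expR (2 * Lam * s).
    by rewrite exprS; field; rewrite expf_neq0.
  apply: lerD; first by rewrite distrC; exact: (rate s).
  apply: (@picard_step_contraction s) => //.
  - by rewrite !mulr_ge0 ?invr_ge0 ?exprn_ge0.
  - exact: picard_iter_continuous.
  - by move=> y r r0 rs; exact: (rate s).
exists u; split => //.
- move=> x; rewrite ustep; apply/rowP => i.
  by rewrite !mxE antiderivative0 addr0.
- move=> x t i t0.
  have -> : (fun s => u x s ord0 i) =
      (fun s => v x ord0 i + antiderivative (rhs u x i) s).
    by apply/funext => s; rewrite ustep mxE.
  rewrite /has_derivative_in.
  under eq_fun do rewrite opprD addrACA subrr add0r.
  have := @antiderivative_has_derivative_in _ _ t (rhs_continuous (x := x) (i := i) cu) t0.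
  by rewrite {2}/rhs (max_r t0).
- move=> T; have [D [Lam [D0 Lam0 lip HD]]] := picard_iter_diff T.
  exists (2 * D / 2 ^+ 0 * expR (2 * Lam * T)) => x t t0 tT.
  rewrite distrC; apply: le_trans (rate _ _ _ D0 HD x t 0%N t0 tT) _.
  rewrite ler_wpM2l ?mulr_ge0 ?invr_ge0 ?exprn_ge0//.
  by rewrite ler_expR ler_wpM2l ?mulr_ge0.
Qed.

End picard.

(** * The nonlocal system *)

Lemma continuous_rV_opp {R : realType} {m : nat} (T : topologicalType)
  (w : T -> 'rV[R]_m) : continuous w -> continuous (fun y => - w y).
Proof. by move=> cw y; apply: cvgN; exact: cw. Qed.

Lemma lipschitz_on_balls_continuous {R : realType} (V W : normedModType R)
    (f : V -> W) :
  (forall rho : R, exists2 C : R, 0 <= C & forall y y',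
     `|y| <= rho -> `|y'| <= rho -> `|f y - f y'| <= C * `|y - y'|) ->
  continuous f.
Proof.
move=> lipf y; apply/cvgrPdist_le => e e0.
have [C C0 HC] := lipf (`|y| + 1).
have C1 : 0 < C + 1 by rewrite ltr_wpDl.
have e1 : 0 < e / (C + 1) by rewrite divr_gt0.
have /cvgrPdist_lt/(_ _ ltr01) := @continuous_id _ y.
have /cvgrPdist_le/(_ _ e1) := @continuous_id _ y.
apply: filterS2 => w /= yw yw1.
apply: le_trans (HC _ _ _ _) _.
- by rewrite lerDl.
- rewrite -[w](subrK y) (le_trans (ler_normD _ _))// addrC lerD2l.
  by rewrite distrC ltW.
- apply: (@le_trans _ _ ((C + 1) * (e / (C + 1)))).
    by apply: ler_pM => //; rewrite lerDl.
  by rewrite mulrC divfK// gt_eqF.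
Qed.

Lemma is_derive_weighted_sum {R : realType} m (a df : 'I_m -> R)
    (f : 'I_m -> R -> R) (t : R) :
  (forall i, is_derive t 1 (f i) (df i)) ->
  is_derive t 1 (fun s => \sum_i a i * f i s) (\sum_i a i * df i).
Proof.
move=> fd.
have -> : (fun s => \sum_i a i * f i s) = \sum_i (a i *: f i : R -> R).
  by apply/funext => s; rewrite fct_sumE.
by apply: is_derive_sum.
Qed.

Section nonlocal_system.
Context {R : realType} {n m : nat}.
Variable Omega : set 'rV[R]_n.
Hypothesis oOmega : open Omega.
Hypothesis bOmega : bounded_set Omega.
Variables (d : 'I_m -> R) (phi : 'rV[R]_n -> 'rV[R]_n -> R) (Phi : R).
Hypothesis d_gt0 : forall i, 0 < d i.
Hypothesis continuous_phi : continuous (fun p => phi p.1 p.2).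
Hypothesis phi_ge0 : forall x y, 0 <= phi x y.
Hypothesis phi_le : forall x y, phi x y <= Phi.
Variable f : 'rV[R]_m -> 'rV[R]_m.
Hypothesis lipschitz_f : exists C : 'rV[R]_m -> 'rV[R]_m -> R,
     [/\ continuous (fun p : 'rV[R]_m * 'rV[R]_m => C p.1 p.2),
         forall y w, 0 <= C y w &
         forall y w, `|f y - f w| <= C y w * `|y - w|].

Let leb := lebesgue_rV R n.
Let vol := fine (leb Omega).
(** The sum serves as a common upper bound of the positive rates [d i]. *)
Let dS := \sum_i d i.
Implicit Types (u : 'rV[R]_n -> R -> 'rV[R]_m) (w : 'rV[R]_n -> 'rV[R]_m).

Definition nonlocal_diffusion w x i :=
  \int[leb]_(y in Omega) (d i * phi x y * (w y ord0 i - w x ord0 i)).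

Let vol0 : 0 <= vol. Proof. exact: fine_ge0. Qed.

Let dS0 : 0 <= dS. Proof. by apply: sumr_ge0 => i _; exact: ltW. Qed.

Let d_dS i : d i <= dS.
Proof.
by rewrite /dS (bigD1 i)//= lerDl; apply: sumr_ge0 => j _; exact: ltW.
Qed.

Let Phi0 : 0 <= Phi. Proof. exact: le_trans (phi_ge0 0 0) (phi_le 0 0). Qed.

Let dphi0 i x y : 0 <= d i * phi x y.
Proof. by rewrite mulr_ge0// ltW. Qed.

Let dphi_le i x y : d i * phi x y <= dS * Phi.
Proof. by apply: ler_pM => //; exact: ltW. Qed.

Let continuous_phir x : continuous (phi x).
Proof.
apply: (@continuous_compose _ _ _ (pair x) _ _ continuous_phi).
by apply: continuous_pair; [exact: continuous_cst|exact: continuous_id].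
Qed.

Lemma continuous_diffusion_integrand w x i : continuous w ->
  continuous (fun y => d i * phi x y * (w y ord0 i - w x ord0 i)).
Proof.
move=> cw; apply: continuous_mul.
  by apply: continuous_mul => //; exact: continuous_cst.
by apply: continuous_sub; [exact: continuous_rV_coord|exact: continuous_cst].
Qed.

(** As the kernel is nonnegative, a one-sided bound on the increments is enough. This is the form of
    the maximum principle used in all the barrier arguments. *)
Lemma nonlocal_diffusion_le w x i c : continuous w -> 0 <= c ->
  (forall y, Omega y -> w y ord0 i - w x ord0 i <= c) ->
  nonlocal_diffusion w x i <= dS * Phi * vol * c.
Proof.
move=> cw c0 wc; rewrite mulrAC.
apply: integral_le_bound => //; first exact: continuous_diffusion_integrand.
move=> y Oy; apply: (@le_trans _ _ (d i * phi x y * c)).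
  by rewrite ler_wpM2l// wc.
by rewrite ler_wpM2r.
Qed.

Lemma nonlocal_diffusion_opp w x i : continuous w ->
  nonlocal_diffusion (fun y => - w y) x i = - nonlocal_diffusion w x i.
Proof.
move=> cw; rewrite -mulN1r -RintegralZl//; last 2 first.
- exact: open_measurable_rV.
- by apply: continuous_integrable => //; exact: continuous_diffusion_integrand.
by apply: eq_Rintegral => y _; rewrite !mxE; ring.
Qed.

Lemma nonlocal_diffusion_sub w w' x i : continuous w -> continuous w' ->
  nonlocal_diffusion w x i - nonlocal_diffusion w' x i =
  nonlocal_diffusion (fun y => w y - w' y) x i.
Proof.
move=> cw cw'; rewrite -RintegralB//; last 3 first.
- exact: open_measurable_rV.
- by apply: continuous_integrable => //; exact: continuous_diffusion_integrand.
- by apply: continuous_integrable => //; exact: continuous_diffusion_integrand.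
by apply: eq_Rintegral => y _; rewrite !mxE; ring.
Qed.

Lemma nonlocal_diffusion_continuous u i : jointly_continuous u ->
  continuous (fun p : 'rV[R]_n * R => nonlocal_diffusion (u ^~ p.2) p.1 i).
Proof.
move=> cu.
apply: (@continuous_parameter_integral R n Omega oOmega bOmega _ (fun q : ('rV[R]_n * R) * 'rV[R]_n =>
   d i * phi q.1.1 q.2 * (u q.2 q.1.2 ord0 i - u q.1.1 q.1.2 ord0 i))).
have c1 : continuous (fun q : ('rV[R]_n * R) * 'rV[R]_n => q.1.1).
  apply: (@continuous_compose _ _ _ fst fst); exact: continuous_fst.
have c2 : continuous (fun q : ('rV[R]_n * R) * 'rV[R]_n => q.1.2).
  apply: (@continuous_compose _ _ _ fst snd); [exact: continuous_fst|exact: continuous_snd].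
have c3 : continuous (fun q : ('rV[R]_n * R) * 'rV[R]_n => q.2) by exact: continuous_snd.
apply: continuous_mul.
  apply: continuous_mul; first exact: continuous_cst.
  exact: (@continuous_compose _ _ _ _ _ (continuous_pair c1 c3) continuous_phi).
apply: continuous_sub; apply: continuous_rV_coord.
  exact: (@continuous_compose _ _ _ _ _ (continuous_pair c3 c2) cu).
exact: (@continuous_compose _ _ _ _ _ (continuous_pair c1 c2) cu).
Qed.

Lemma compact_rV_ball k (rho : R) : compact [set y : 'rV[R]_k | `|y| <= rho].
Proof.
apply: bounded_closed_compact.
  by exists rho; split; [exact: num_real|move=> N rN y /= /le_trans; apply; exact: ltW].
apply: (@closed_comp _ _ (fun x : 'rV[R]_k => `|x|) [set r | r <= rho]) => //.
by move=> y _; exact: norm_continuous.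
Qed.

(** The continuous local Lipschitz constant is bounded on the compact product of two closed
    balls. *)
Lemma lipschitz_on_balls (rho : R) : exists2 C : R, 0 <= C &
  forall y y' : 'rV[R]_m, `|y| <= rho -> `|y'| <= rho ->
    `|f y - f y'| <= C * `|y - y'|.
Proof.
have [C [cC C0 fC]] := lipschitz_f.
have [M [M0 HM]] := compact_norm_bounded
  (compact_setX (@compact_rV_ball m rho) (@compact_rV_ball m rho))
  (continuous_subspaceT cC).
exists M => // y w yr wr; apply: le_trans (fC _ _) _.
rewrite ler_wpM2r//; apply: le_trans (HM (y, w) _); last by split.
exact: ler_norm.
Qed.

Lemma continuous_f : continuous f.
Proof. exact: lipschitz_on_balls_continuous lipschitz_on_balls. Qed.

Definition clamp (M : R) (y : 'rV[R]_m) : 'rV[R]_m :=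
  \row_i Num.max 0 (Num.min (y ord0 i) M).

Lemma clamp_orthant M y : orthant m (clamp M y).
Proof. by move=> i; rewrite mxE le_max lexx. Qed.

Lemma clamp_norm_le M y : 0 <= M -> `|clamp M y| <= M.
Proof.
move=> M0; apply: rV_norm_le => // i; rewrite mxE ger0_norm ?le_max ?lexx//.
by rewrite ge_max M0 ge_min lexx orbT.
Qed.

Lemma clamp_lipschitz M y y' : `|clamp M y - clamp M y'| <= `|y - y'|.
Proof.
apply: rV_norm_le => // i; rewrite !mxE.
have := le_coord_rV_norm (y - y') i; rewrite !mxE.
rewrite !ler_norml => /andP[h1 h2]; apply/andP; split.
  rewrite /Num.max /Num.min; do ! case: ifPn; rewrite -?leNgt; lra.
rewrite /Num.max /Num.min; do ! case: ifPn; rewrite -?leNgt; lra.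
Qed.

Lemma clamp_id M y : orthant m y -> (forall i, y ord0 i <= M) -> clamp M y = y.
Proof.
by move=> y0 yM; apply/rowP => i; rewrite mxE min_l ?yM// max_r.
Qed.

(** * The truncated system: Lipschitz bounds, positivity and growth *)

Section truncated_system.
Variable M : R -> R.
Hypothesis continuousM : continuous M.
Hypothesis M_ge0 : forall t, 0 <= M t.
Variable v : 'rV[R]_n -> 'rV[R]_m.
Hypothesis continuous_v : continuous v.
Hypothesis bounded_v : exists2 Mv, 0 <= Mv & forall x, `|v x| <= Mv.

(** Only the reaction is clamped: the diffusion is linear and bounded in the sup norm, hence already
    globally Lipschitz. *)
Definition truncated_rhs (t : R) w x : 'rV[R]_m :=
  \row_i (nonlocal_diffusion w x i + f (clamp (M t) (w x)) ord0 i).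

Lemma truncated_rhs_continuous u : jointly_continuous u ->
  jointly_continuous (fun x t => truncated_rhs t (u ^~ t) x).
Proof.
move=> cu; apply: continuous_rV => i; rewrite /truncated_rhs.
under eq_fun do rewrite mxE.
apply: continuous_add; first exact: nonlocal_diffusion_continuous.
apply: continuous_rV_coord; apply: continuous_compose continuous_f.
apply: continuous_rV => j; rewrite /clamp; under eq_fun do rewrite mxE.
apply: continuous_maxr; first exact: continuous_cst.
apply: continuous_minr; first by apply: continuous_rV_coord; exact: cu.
by apply: continuous_compose continuousM; exact: continuous_snd.
Qed.

Let M_le T : exists2 MT, 0 <= MT & forall t, 0 <= t -> t <= T -> M t <= MT.
Proof.
have [MT [MT0 HMT]] := compact_norm_bounded (@segment_compact R 0 T)
  (continuous_subspaceT continuousM).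
exists MT => // t t0 tT; apply: le_trans (ler_norm _) (HMT _ _).
by rewrite /= in_itv/= t0.
Qed.

Lemma truncated_rhs_lipschitz T : exists2 Lam, 0 <= Lam &
  forall t w w' B, 0 <= t -> t <= T -> continuous w -> continuous w' -> 0 <= B ->
    (forall x, `|w x - w' x| <= B) ->
    forall x, `|truncated_rhs t w x - truncated_rhs t w' x| <= Lam * B.
Proof.
have [MT MT0 HMT] := M_le T; have [C C0 HC] := lipschitz_on_balls MT.
have K0 : 0 <= dS * Phi * vol by rewrite !mulr_ge0.
(* The factor 2 arises because an increment of [w - w'] between two points is at most [2 * B]; [C]
   is the Lipschitz constant of [f] on the ball that contains all clamped values up to time [T]. *)
exists (dS * Phi * vol * 2 + C) => [|t w w' B t0 tT cw cw' B0 ww' x].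
  by rewrite addr_ge0// mulr_ge0.
have cc : continuous (fun y => w y - w' y).
  apply: continuous_rV => i; under eq_fun do rewrite !mxE.
  by apply: continuous_sub; exact: continuous_rV_coord.
have bB y i : `|(w y - w' y) ord0 i| <= B.
  exact: le_trans (le_coord_rV_norm _ _) (ww' y).
apply: rV_norm_le => [|i]; first by rewrite mulr_ge0 ?addr_ge0 ?mulr_ge0.
rewrite !mxE opprD addrACA nonlocal_diffusion_sub//.
rewrite (le_trans (ler_normD _ _))// mulrDl lerD//.
  rewrite ler_norml; apply/andP; split.
    rewrite lerNl -nonlocal_diffusion_opp// -[leRHS]mulrA.
    apply: nonlocal_diffusion_le; first exact: continuous_rV_opp.
      by rewrite mulr_ge0.
    move=> y _; have := bB y i; have := bB x i.
    by rewrite !mxE !ler_norml => /andP[? ?] /andP[? ?]; lra.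
  rewrite -[leRHS]mulrA; apply: nonlocal_diffusion_le => //; first by rewrite mulr_ge0.
  move=> y _; have := bB y i; have := bB x i.
  by rewrite !mxE !ler_norml => /andP[? ?] /andP[? ?]; lra.
have := le_coord_rV_norm (f (clamp (M t) (w x)) - f (clamp (M t) (w' x))) i.
rewrite !mxE => /le_trans; apply.
apply: le_trans (HC _ _ _ _) _; try by
  apply: le_trans (clamp_norm_le _ _) (HMT _ t0 tT).
by rewrite ler_wpM2l// (le_trans (clamp_lipschitz _ _ _)).
Qed.

Lemma truncated_rhs_bounded T : exists2 D, 0 <= D &
  forall t x, 0 <= t -> t <= T -> `|truncated_rhs t v x| <= D.
Proof.
have [MT MT0 HMT] := M_le T; have [Mv Mv0 HMv] := bounded_v.
have [Mf [Mf0 HMf]] := compact_norm_bounded (@compact_rV_ball m MT)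
  (continuous_subspaceT continuous_f).
have K0 : 0 <= dS * Phi * vol by rewrite !mulr_ge0.
exists (dS * Phi * vol * (2 * Mv) + Mf) => [|t x t0 tT].
  by rewrite addr_ge0// mulr_ge0// mulr_ge0.
have bB y i : `|v y ord0 i| <= Mv.
  exact: le_trans (le_coord_rV_norm _ _) (HMv y).
apply: rV_norm_le => [|i]; first by rewrite addr_ge0 ?mulr_ge0 ?mulr_ge0.
rewrite !mxE (le_trans (ler_normD _ _))// lerD//.
  rewrite ler_norml; apply/andP; split.
    rewrite lerNl -nonlocal_diffusion_opp//.
    apply: nonlocal_diffusion_le; first exact: continuous_rV_opp.
      by rewrite mulr_ge0.
    move=> y _; have := bB y i; have := bB x i.
    by rewrite !mxE !ler_norml => /andP[? ?] /andP[? ?]; lra.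
  apply: nonlocal_diffusion_le => //; first by rewrite mulr_ge0.
  move=> y _; have := bB y i; have := bB x i.
  by rewrite !ler_norml => /andP[? ?] /andP[? ?]; lra.
apply: le_trans (le_coord_rV_norm _ _) _; apply: HMf => /=.
exact: le_trans (clamp_norm_le _ _) (HMT _ t0 tT).
Qed.

Section truncated_solution.
Variable u : 'rV[R]_n -> R -> 'rV[R]_m.
Hypothesis continuous_u : jointly_continuous u.
Hypothesis u_init : forall x, u x 0 = v x.
Hypothesis u_derive : forall x (t : R) i, 0 < t ->
  is_derive t 1 (fun s => u x s ord0 i) (truncated_rhs t (u ^~ t) x ord0 i).
Hypothesis u_bounded : forall T, exists B, forall x t,
  0 <= t -> t <= T -> `|u x t - v x| <= B.
Hypothesis v_ge0 : forall x, orthant m (v x).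
Hypothesis f_quasipositive : forall i y,
  orthant m y -> y ord0 i = 0 -> 0 <= f y ord0 i.

Let continuous_ux x i : continuous (fun s => u x s ord0 i).
Proof.
apply: continuous_rV_coord.
apply: (@continuous_compose _ _ _ (fun s => (x, s)) _ _ continuous_u).
by apply: continuous_pair; [exact: continuous_cst|exact: continuous_id].
Qed.

Let u_norm_bounded T : exists B, forall x t, 0 <= t -> t <= T -> `|u x t| <= B.
Proof.
have [B HB] := u_bounded T; have [Mv Mv0 HMv] := bounded_v.
exists (B + Mv) => x t t0 tT.
by rewrite -[u x t](subrK (v x)) (le_trans (ler_normD _ _))// lerD// HB.
Qed.

(** Where component j is negative, clamping sets it to 0 and quasi-positivity makes the reaction
    nonnegative. Only the diffusion can push the component further down, at a rate controlled by the
    largest negative part, and [halving] brings that part to 0. *)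
Lemma truncated_solution_ge0 x t : 0 <= t -> orthant m (u x t).
Proof.
move=> t0 i; set Lam := dS * Phi * vol.
have Lam0 : 0 <= Lam by rewrite !mulr_ge0.
have [B0 HB0] := u_norm_bounded t.
rewrite -oppr_le0.
have := @halving R ('rV[R]_n * R * 'I_m) [set z | 0 <= z.1.2 /\ z.1.2 <= t]
  (fun z => - u z.1.1 z.1.2 ord0 z.2) (fun z => expR (2 * Lam * z.1.2)) B0.
move=> /(_ _ _ _ ((x, t), i)) /=; apply => //.
- by move=> [[y s] j] /= [s0 st]; rewrite -expR0 ler_expR !mulr_ge0.
- move=> [[y s] j] /= [s0 st]; apply: le_trans (HB0 y s s0 st).
  by apply: le_trans (le_coord_rV_norm _ j); rewrite -normrN ler_norm.
move=> B BB HB [[y r] j] /= [r0 rt].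
rewrite -subr_le0.
apply: (@barrier R (fun s => - u y s ord0 j - B / 2 * expR (2 * Lam * s))
  (fun s => - truncated_rhs s (u ^~ s) y ord0 j -
            B / 2 * (2 * Lam) * expR (2 * Lam * s)) t) => //.
- apply: continuous_sub; last exact: continuous_scaled_exp.
  by apply: continuous_opp; exact: continuous_ux.
- rewrite u_init mulr0 expR0 mulr1.
  by have := v_ge0 y j; lra.
- move=> s s0 st _; apply: is_deriveB; last exact: is_derive_scaled_exp.
  by apply: is_deriveN; exact: u_derive.
- move=> s s0 st gs.
  have es := expR_gt0 (2 * Lam * s).
  (* The barrier is examined only where it is positive, and this forces the component to be
     negative. *)
  have uneg : u y s ord0 j < 0.
    have : 0 <= B / 2 * expR (2 * Lam * s) by rewrite !mulr_ge0// ltW.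
    by move: gs; lra.
  rewrite mxE.
  have fj : 0 <= f (clamp (M s) (u y s)) ord0 j.
    apply: f_quasipositive; first exact: clamp_orthant.
    by rewrite mxE max_l// ge_min (ltW uneg).
  have : - nonlocal_diffusion (u ^~ s) y j <= Lam * (B * expR (2 * Lam * s)).
    rewrite -nonlocal_diffusion_opp; last exact: jointly_continuous_slice.
    apply: nonlocal_diffusion_le.
    - by apply: continuous_rV_opp; exact: jointly_continuous_slice.
    - by rewrite mulr_ge0// ltW.
    (* Since the component is negative at [y], the increment is bounded by [B * expR (2 * Lam * s)]
       without a factor 2, which is exactly what the barrier allows. *)
    - move=> z _; rewrite !mxE.
      by have := HB ((z, s), j) (conj (ltW s0) (ltW st)); move: uneg => /=; lra.
  have -> : B / 2 * (2 * Lam) * expR (2 * Lam * s) =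
    Lam * (B * expR (2 * Lam * s)) by field.
  by move: fj; lra.
Qed.

Variables (a : 'I_m -> R) (amin K L : R).
Hypothesis a_ge : forall i, amin <= a i.
Hypothesis amin_gt0 : 0 < amin.
Hypothesis K_ge0 : 0 <= K.
Hypothesis f_balance : forall y, orthant m y ->
  \sum_(i < m) a i * f y ord0 i <= K + L * \sum_(i < m) y ord0 i.

Let mass x t := \sum_i a i * u x t ord0 i.

Let a0 i : 0 < a i. Proof. exact: lt_le_trans (a_ge i). Qed.

Let coord_le_mass x t i : 0 <= t -> amin * u x t ord0 i <= mass x t.
Proof.
move=> t0; have u0 := truncated_solution_ge0 x t0.
rewrite /mass (bigD1 i)//=; apply: (@le_trans _ _ (a i * u x t ord0 i)).
  by rewrite ler_wpM2r.
by rewrite lerDl; apply: sumr_ge0 => j _; rewrite mulr_ge0// ltW.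
Qed.

(** If the mass is at most S everywhere, each component and also the sum of the components is at
    most [S / amin]. The first summand is then the gain by diffusion per unit of S, the second the
    gain by reaction. *)
Let growth := (\sum_i a i) * (dS * Phi * vol) / amin + `|L| / amin.

(** The halving scheme is applied to the excess of the mass over [A * expR ((growth + 1) * t)]. The
    additional rate 1 contributes [A * expR ((growth + 1) * t) >= A >= K], which absorbs the
    constant source [K]. *)
Lemma truncated_solution_growth A x t : K <= A ->
  (forall y, \sum_i a i * v y ord0 i <= A) -> 0 <= t ->
  \sum_i a i * u x t ord0 i <= A * expR ((growth + 1) * t).
Proof.
move=> KA vA t0.
have sa0 : 0 <= \sum_i a i by apply: sumr_ge0 => i _; exact: ltW.
have g0 : 0 <= growth.
  by rewrite addr_ge0 ?divr_ge0// ?mulr_ge0// ltW.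
have A0 : 0 <= A by exact: le_trans KA.
have [B0 HB0] := u_norm_bounded t.
rewrite -subr_le0.
have := @halving R ('rV[R]_n * R) [set z | 0 <= z.2 /\ z.2 <= t]
  (fun z => mass z.1 z.2 - A * expR ((growth + 1) * z.2))
  (fun z => expR (2 * growth * z.2)) ((\sum_i a i) * B0).
move=> /(_ _ _ _ (x, t)) /=; apply => //.
- by move=> [y s] /= [s0 st]; rewrite -expR0 ler_expR !mulr_ge0.
- move=> [y s] /= [s0 st].
  apply: (@le_trans _ _ (mass y s)).
    by rewrite gerBl mulr_ge0 ?expR_ge0.
  rewrite /mass mulr_suml; apply: ler_sum => i _; rewrite ler_wpM2l//; first exact: ltW.
  apply: le_trans (HB0 y s s0 st).
  by apply: le_trans (le_coord_rV_norm _ i); rewrite ler_norm.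
move=> B BB HB [y r] /= [r0 rt].
rewrite -subr_le0.
apply: (@barrier R (fun s => mass y s - A * expR ((growth + 1) * s) -
    B / 2 * expR (2 * growth * s))
  (fun s => (\sum_i a i * truncated_rhs s (u ^~ s) y ord0 i) -
            A * (growth + 1) * expR ((growth + 1) * s) -
            B / 2 * (2 * growth) * expR (2 * growth * s)) t) => //.
- apply: continuous_sub; last exact: continuous_scaled_exp.
  apply: continuous_sub; last exact: continuous_scaled_exp.
  apply: continuous_sum => i; apply: continuous_mul => //.
  exact: continuous_cst.
- rewrite !mulr0 expR0 !mulr1 /mass u_init.
  by have := vA y; lra.
- move=> s s0 st _; apply: is_deriveB; last exact: is_derive_scaled_exp.
  apply: is_deriveB; last exact: is_derive_scaled_exp.
  by apply: is_derive_weighted_sum => i; exact: u_derive.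
- move=> s s0 st gs.
  have := expR_ge0 (2 * growth * s); have := expR_ge0 ((growth + 1) * s).
  have : 1 <= expR ((growth + 1) * s).
    rewrite -expR0 ler_expR; apply: mulr_ge0; last exact: ltW.
    exact: addr_ge0.
  set E1 := expR _; set E2 := expR _ => E11 E10 E20.
  (* [S] bounds the mass at time [s] at every point, by the assumption that is being halved. *)
  set S := A * E1 + B * E2.
  have S0 : 0 <= S by rewrite addr_ge0// mulr_ge0.
  have massS z : mass z s <= S.
    by have := HB (z, s) (conj (ltW s0) (ltW st)); rewrite /= -/E1 -/E2 /S; lra.
  have uS z i : u z s ord0 i <= S / amin.
    rewrite ler_pdivlMr// mulrC; apply: le_trans (massS z).
    exact: coord_le_mass (ltW s0).
  have usum z : \sum_i u z s ord0 i <= S / amin.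
    rewrite ler_pdivlMr// mulrC; apply: le_trans (massS z).
    rewrite mulr_sumr; apply: ler_sum => i _.
    by rewrite ler_wpM2r//; exact: truncated_solution_ge0 (ltW s0) _.
  have : \sum_i a i * truncated_rhs s (u ^~ s) y ord0 i <= growth * S + K.
    under eq_bigr do rewrite mxE mulrDr.
    rewrite big_split/= mulrDl -addrA; apply: lerD.
      rewrite -!mulrA mulr_suml; apply: ler_sum => i _.
      rewrite ler_wpM2l//; first exact: ltW.
      rewrite !mulrA -[leRHS]mulrA [_^-1 * _]mulrC.
      apply: nonlocal_diffusion_le.
      - exact: jointly_continuous_slice.
      - by rewrite divr_ge0// ltW.
      - move=> z _; have := uS z i.
        by have := truncated_solution_ge0 y (ltW s0) i; lra.
    (* The balance condition is evaluated at the clamped vector. As [L] has no fixed sign it is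
       replaced by its absolute value before the clamped sum is bounded by the sum of the components
       of [u]. *)
    apply: (le_trans (f_balance (clamp_orthant _ _))).
    rewrite [leRHS]addrC lerD2l.
    apply: (@le_trans _ _ (`|L| * \sum_i u y s ord0 i)); last first.
      by rewrite mulrAC -mulrA ler_wpM2l.
    apply: (@le_trans _ _ (`|L| * \sum_i clamp (M s) (u y s) ord0 i)).
      rewrite ler_wpM2r ?ler_norm//.
      by apply: sumr_ge0 => i _; exact: clamp_orthant.
    rewrite ler_wpM2l//; apply: ler_sum => i _.
    rewrite mxE ge_max ge_min lexx andbT.
    exact: truncated_solution_ge0 (ltW s0) _.
  have KE : K <= A * E1.
    by apply: (le_trans KA); rewrite ler_peMr.
  have -> : B / 2 * (2 * growth) * E2 = growth * (B * E2) by field.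
  have -> : A * (growth + 1) * E1 = growth * (A * E1) + A * E1 by ring.
  rewrite /S mulrDr.
  by move: KE; lra.
Qed.

End truncated_solution.

End truncated_system.

(** * The system itself: existence, uniqueness and boundedness of the mass *)

Section solutions_of_the_system.

Definition system_rhs w x : 'rV[R]_m :=
  \row_i (nonlocal_diffusion w x i + f (w x) ord0 i).

Lemma system_rhs_continuous u : jointly_continuous u ->
  jointly_continuous (fun x t => system_rhs (u ^~ t) x).
Proof.
move=> cu; apply: continuous_rV => i; rewrite /system_rhs.
under eq_fun do rewrite mxE.
apply: continuous_add; first exact: nonlocal_diffusion_continuous.
by apply: continuous_rV_coord; apply: continuous_compose continuous_f; exact: cu.
Qed.

Lemma system_existence (v : 'rV[R]_n -> 'rV[R]_m) (a : 'I_m -> R) (K L : R) :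
  continuous v -> (exists2 Mv, 0 <= Mv & forall x, `|v x| <= Mv) ->
  (forall x, orthant m (v x)) ->
  (forall i y, orthant m y -> y ord0 i = 0 -> 0 <= f y ord0 i) ->
  (forall i, 0 < a i) -> 0 <= K ->
  (forall y, orthant m y ->
     \sum_(i < m) a i * f y ord0 i <= K + L * \sum_(i < m) y ord0 i) ->
  exists u, [/\ jointly_continuous u, forall x, u x 0 = v x,
    forall x t i, 0 <= t -> has_derivative_in (time_interval (+oo%E : \bar R))
      (fun s => u x s ord0 i) t (system_rhs (u ^~ t) x ord0 i) &
    forall x t, 0 <= t -> orthant m (u x t)].
Proof.
move=> cv bv v0 qp a0 K0 bal.
have [amin amin0 amin_le] := positive_lower_bound a0.
have [Mv Mv0 HMv] := bv.
have sa0 : 0 <= \sum_i a i by apply: sumr_ge0 => i _; exact: ltW.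
(* [A] dominates both [K] and the initial mass, the two demands of the growth estimate. *)
pose A := K + (\sum_i a i) * Mv.
have KA : K <= A by rewrite lerDl mulr_ge0.
have A0 : 0 <= A by exact: le_trans KA.
pose M t := A / amin *
  expR (((\sum_i a i) * (dS * Phi * vol) / amin + `|L| / amin + 1) * t).
have cM : continuous M by exact: continuous_scaled_exp.
have M0 t : 0 <= M t by rewrite mulr_ge0 ?expR_ge0// divr_ge0// ltW.
have [u [cu u0 du bu]] := picard_existence (truncated_rhs_continuous cM)
  (truncated_rhs_lipschitz cM M0) cv (truncated_rhs_bounded cM M0 cv bv).
have du' x (t : R) i : 0 < t ->
    is_derive t 1 (fun s => u x s ord0 i) (truncated_rhs M t (u ^~ t) x ord0 i).
  by move=> t0; apply: has_derivative_in_is_derive => //; apply: du; exact: ltW.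
have unn x t : 0 <= t -> orthant m (u x t).
  exact: (truncated_solution_ge0 bv cu u0 du' bu v0 qp).
have vA y : \sum_i a i * v y ord0 i <= A.
  apply: (@le_trans _ _ ((\sum_i a i) * Mv)); last by rewrite lerDr.
  rewrite mulr_suml; apply: ler_sum => i _; rewrite ler_wpM2l//; first exact: ltW.
  apply: le_trans (HMv y).
  by apply: le_trans (le_coord_rV_norm _ i); rewrite ler_norm.
(* Each component is at most the mass divided by [amin], hence at most [M t]: the cap is never
   reached from above and [u] solves the original system. *)
have uM x t : 0 <= t -> clamp (M t) (u x t) = u x t.
  move=> t0; apply: clamp_id => [|i]; first exact: unn.
  have := truncated_solution_growth bv cu u0 du' bu v0 qp amin_le amin0 K0 bal
    x KA vA t0.
  move=> H; rewrite /M mulrAC ler_pdivlMr// mulrC; apply: le_trans H.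
  rewrite (bigD1 i)//=; apply: (@le_trans _ _ (a i * u x t ord0 i)).
    by rewrite ler_wpM2r//; exact: unn.
  by rewrite lerDl; apply: sumr_ge0 => j _; rewrite mulr_ge0 ?unn// ltW.
exists u; split => // x t i t0.
by have := du x t i t0; rewrite /truncated_rhs /system_rhs !mxE uM.
Qed.

(** Both functions are bounded on the compact closure of the space-time cylinder, so a single
    Lipschitz constant of [f] serves, and [halving] is applied to the norm of their difference over
    [Omega]. *)
Lemma system_uniqueness u z T : jointly_continuous u -> jointly_continuous z ->
  (forall x, Omega x -> u x 0 = z x 0) ->
  (forall x (t : R) i, Omega x -> 0 < t -> t < T ->
    is_derive t 1 (fun s => u x s ord0 i) (system_rhs (u ^~ t) x ord0 i)) ->
  (forall x (t : R) i, Omega x -> 0 < t -> t < T ->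
    is_derive t 1 (fun s => z x s ord0 i) (system_rhs (z ^~ t) x ord0 i)) ->
  forall x t, Omega x -> 0 <= t -> t <= T -> u x t = z x t.
Proof.
move=> cu cz uz0 du dz x t Ox t0 tT.
have cK : compact (closure Omega `*` `[0, T]%classic).
  by apply: compact_setX; [exact: closure_bounded_compact|exact: segment_compact].
have [Bu [Bu0 HBu]] := compact_norm_bounded cK (continuous_subspaceT cu).
have [Bz [Bz0 HBz]] := compact_norm_bounded cK (continuous_subspaceT cz).
have [C C0 HC] := lipschitz_on_balls (Bu + Bz).
set Lam := dS * Phi * vol * 2 + C.
have K0 : 0 <= dS * Phi * vol by rewrite !mulr_ge0.
have Lam0 : 0 <= Lam by rewrite addr_ge0// mulr_ge0.
have inK y s : Omega y -> 0 <= s -> s <= T ->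
    (closure Omega `*` `[0, T]%classic) (y, s).
  by move=> Oy s0 sT; split => /=; [exact: subset_closure|rewrite in_itv/= s0].
have uB y s : Omega y -> 0 <= s -> s <= T -> `|u y s| <= Bu + Bz.
  by move=> Oy s0 sT; apply: le_trans (HBu (y, s) (inK _ _ Oy s0 sT)) _; rewrite lerDl.
have zB y s : Omega y -> 0 <= s -> s <= T -> `|z y s| <= Bu + Bz.
  by move=> Oy s0 sT; apply: le_trans (HBz (y, s) (inK _ _ Oy s0 sT)) _; rewrite lerDr.
apply/eqP; rewrite -subr_eq0 -normr_le0.
have := @halving R ('rV[R]_n * R) [set q | [/\ Omega q.1, 0 <= q.2 & q.2 <= T]]
  (fun q => `|u q.1 q.2 - z q.1 q.2|) (fun q => expR (2 * Lam * q.2))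
  ((Bu + Bz) + (Bu + Bz)).
move=> /(_ _ _ _ (x, t)) /=; apply => //.
- by move=> [y s] /= [_ s0 st]; rewrite -expR0 ler_expR !mulr_ge0.
- move=> [y s] /= [Oy s0 st].
  by rewrite (le_trans (ler_normB _ _))// lerD ?uB ?zB.
move=> B BB HB [y r] /= [Oy r0 rt].
(* A one-sided estimate by coordinate, stated for an arbitrary pair because it is applied to
   [(u, z)] and to [(z, u)]. *)
have half (u1 u2 : 'rV[R]_n -> R -> 'rV[R]_m) :
  jointly_continuous u1 -> jointly_continuous u2 ->
  (forall x, Omega x -> u1 x 0 = u2 x 0) ->
  (forall x (t : R) i, Omega x -> 0 < t -> t < T ->
    is_derive t 1 (fun s => u1 x s ord0 i) (system_rhs (u1 ^~ t) x ord0 i)) ->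
  (forall x (t : R) i, Omega x -> 0 < t -> t < T ->
    is_derive t 1 (fun s => u2 x s ord0 i) (system_rhs (u2 ^~ t) x ord0 i)) ->
  (forall y s, Omega y -> 0 <= s -> s <= T -> `|u1 y s| <= Bu + Bz) ->
  (forall y s, Omega y -> 0 <= s -> s <= T -> `|u2 y s| <= Bu + Bz) ->
  (forall y s, Omega y -> 0 <= s -> s <= T ->
     `|u1 y s - u2 y s| <= B * expR (2 * Lam * s)) ->
  forall i, u1 y r ord0 i - u2 y r ord0 i <= B / 2 * expR (2 * Lam * r).
  move=> cu1 cu2 u120 du1 du2 u1B u2B u12 i; rewrite -subr_le0.
  have cc (w : 'rV[R]_n -> R -> 'rV[R]_m) : jointly_continuous w ->
      continuous (fun s => w y s ord0 i).
    move=> cw; apply: continuous_rV_coord.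
    apply: (@continuous_compose _ _ _ (fun s => (y, s)) _ _ cw).
    by apply: continuous_pair; [exact: continuous_cst|exact: continuous_id].
  apply: (@barrier R (fun s => u1 y s ord0 i - u2 y s ord0 i - B / 2 * expR (2 * Lam * s))
    (fun s => system_rhs (u1 ^~ s) y ord0 i - system_rhs (u2 ^~ s) y ord0 i -
      B / 2 * (2 * Lam) * expR (2 * Lam * s)) T) => //.
  - apply: continuous_sub; last exact: continuous_scaled_exp.
    by apply: continuous_sub; exact: cc.
  - by rewrite u120// subrr sub0r oppr_le0 !mulr_ge0 ?expR_ge0.
  - move=> s s0 sT _; apply: is_deriveB; last exact: is_derive_scaled_exp.
    by apply: is_deriveB; [exact: du1|exact: du2].
  - move=> s s0 sT _; rewrite !mxE.
    have S0 : 0 <= B * expR (2 * Lam * s) by rewrite mulr_ge0 ?expR_ge0.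
    have bB q : Omega q -> `|(u1 q s - u2 q s) ord0 i| <= B * expR (2 * Lam * s).
      move=> Oq; apply: le_trans (le_coord_rV_norm _ _) _.
      by apply: u12 => //; exact: ltW.
    have H1 : nonlocal_diffusion (u1 ^~ s) y i - nonlocal_diffusion (u2 ^~ s) y i <=
        dS * Phi * vol * (2 * (B * expR (2 * Lam * s))).
      rewrite nonlocal_diffusion_sub; try exact: jointly_continuous_slice.
      apply: nonlocal_diffusion_le.
      - apply: continuous_rV => j; under eq_fun do rewrite !mxE.
        by apply: continuous_sub; apply: continuous_rV_coord;
          exact: jointly_continuous_slice.
      - by rewrite mulr_ge0.
      - move=> q Oq; have := bB q Oq; have := bB y Oy.
        by rewrite !ler_norml => /andP[? ?] /andP[? ?]; lra.
    have H2 : f (u1 y s) ord0 i - f (u2 y s) ord0 i <= C * (B * expR (2 * Lam * s)).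
      have := le_coord_rV_norm (f (u1 y s) - f (u2 y s)) i.
      rewrite !mxE => H; apply: (le_trans (ler_norm _)); apply: (le_trans H).
      apply: le_trans (HC _ _ _ _) _; [exact: u1B (ltW s0) (ltW sT)|
        exact: u2B (ltW s0) (ltW sT)|].
      by rewrite ler_wpM2l// u12// ltW.
    have -> : B / 2 * (2 * Lam) * expR (2 * Lam * s) =
      dS * Phi * vol * (2 * (B * expR (2 * Lam * s))) + C * (B * expR (2 * Lam * s)).
      by rewrite /Lam; field.
    by move: H1 H2; lra.
have HB' q s : Omega q -> 0 <= s -> s <= T ->
    `|u q s - z q s| <= B * expR (2 * Lam * s).
  by move=> Oq s0 sT; exact: (HB (q, s)).
apply: rV_norm_le => [|i]; first by rewrite !mulr_ge0 ?expR_ge0.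
rewrite !mxE ler_norml; apply/andP; split; last first.
  exact: (half u z).
rewrite lerNl opprB; apply: (half z u) => //.
- by move=> q Oq; rewrite uz0.
- by move=> q s Oq s0 sT; rewrite distrC; exact: HB'.
Qed.

(** Two applications of [linear_comparison]: first to the integral of the mass, with rate [l], then
    to the mass at a point, with rate [dmin * eps + l]. The first allows [l = 0], in which case
    [K = 0] makes the integral nonincreasing; the second has a positive rate by assumption. *)
Lemma system_mass_bounded u (a : 'I_m -> R) (K l dmin eps Mv : R) :
  (forall x y, Omega x -> Omega y -> phi x y = phi y x) ->
  (forall x, Omega x -> eps <= \int[leb]_(y in Omega) phi x y) ->
  (forall i, dmin <= d i) -> 0 <= dmin ->
  (forall i, 0 < a i) -> 0 <= K -> 0 <= l -> (l = 0 -> K = 0) ->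
  0 < dmin * eps + l ->
  (forall y, orthant m y ->
     \sum_(i < m) a i * f y ord0 i <= K - l * \sum_(i < m) a i * y ord0 i) ->
  jointly_continuous u -> (forall x, `|u x 0| <= Mv) ->
  (forall x (t : R) i, 0 < t ->
    is_derive t 1 (fun s => u x s ord0 i) (system_rhs (u ^~ t) x ord0 i)) ->
  (forall x t, 0 <= t -> orthant m (u x t)) ->
  exists C, forall x t, Omega x -> 0 <= t -> \sum_i a i * u x t ord0 i <= C.
Proof.
move=> phiC epsphi dmin_le dmin0 a0 K0 l0 lK rho0 bal cu uMv du unn.
have mO : measurable Omega by exact: open_measurable_rV.
pose mass x t := \sum_i a i * u x t ord0 i.
pose dmass x t := \sum_i a i * system_rhs (u ^~ t) x ord0 i.
have mass0 x t : 0 <= t -> 0 <= mass x t.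
  by move=> t0; apply: sumr_ge0 => i _; rewrite mulr_ge0 ?unn// ltW.
have dmassE x (t : R) : 0 < t -> is_derive t 1 (mass x) (dmass x t).
  by move=> t0; apply: is_derive_weighted_sum => i; exact: du.
have cmass : continuous (fun p => mass p.1 p.2).
  apply: continuous_sum => i; apply: continuous_mul; first exact: continuous_cst.
  exact: continuous_rV_coord.
have cmass_t x : continuous (mass x).
  apply: (@continuous_compose _ _ _ (fun s => (x, s)) _ _ cmass).
  by apply: continuous_pair; [exact: continuous_cst|exact: continuous_id].
have cmass_x t : continuous (mass ^~ t).
  apply: (@continuous_compose _ _ _ (fun x => (x, t)) _ _ cmass).
  by apply: continuous_pair; [exact: continuous_id|exact: continuous_cst].
(* The integrand of the weighted total diffusion; by the symmetry of [phi] it changes sign when the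
   two points of [Omega] are exchanged. *)
pose h t (p : 'rV[R]_n * 'rV[R]_n) :=
  \sum_i a i * (d i * phi p.1 p.2 * (u p.2 t ord0 i - u p.1 t ord0 i)).
have ch t : continuous (h t).
  have cx i : continuous (fun x => u x t ord0 i).
    by apply: continuous_rV_coord; exact: jointly_continuous_slice.
  apply: continuous_sum => i; apply: continuous_mul; first exact: continuous_cst.
  apply: continuous_mul; first by apply: continuous_mul => //; exact: continuous_cst.
  apply: continuous_sub; apply: continuous_compose (cx i).
    exact: continuous_snd.
  exact: continuous_fst.
have hE t x : \sum_i a i * nonlocal_diffusion (u ^~ t) x i =
    \int[leb]_(y in Omega) h t (x, y).
  rewrite integral_weighted_sum// => i.
  by apply: continuous_diffusion_integrand; exact: jointly_continuous_slice.
have cf t i : continuous (fun x => f (u x t) ord0 i).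
  apply: continuous_rV_coord; apply: continuous_compose continuous_f.
  exact: jointly_continuous_slice.
have csf t : continuous (fun x => \sum_i a i * f (u x t) ord0 i).
  apply: continuous_sum => i; apply: continuous_mul => //; exact: continuous_cst.
have chi t : continuous (fun x => \int[leb]_(y in Omega) h t (x, y)).
  exact: continuous_parameter_integral.
have dmass_split x t : dmass x t =
    \int[leb]_(y in Omega) h t (x, y) + \sum_i a i * f (u x t) ord0 i.
  by rewrite -hE /dmass -big_split/=; apply: eq_bigr => i _; rewrite mxE mulrDr.
pose W t := \int[leb]_(x in Omega) mass x t.
have cW : continuous W.
  apply: (@continuous_parameter_integral _ _ _ oOmega bOmega _
    (fun q : R * 'rV[R]_n => mass q.2 q.1)).
  apply: (@continuous_compose _ _ _ (fun q : R * 'rV[R]_n => (q.2, q.1)) _ _ cmass).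
  by apply: continuous_pair; [exact: continuous_snd|exact: continuous_fst].
have cdmass : continuous (fun p : R * 'rV[R]_n => dmass p.2 p.1).
  have sw : continuous (fun q : R * 'rV[R]_n => (q.2, q.1)).
    by apply: continuous_pair; [exact: continuous_snd|exact: continuous_fst].
  apply: continuous_sum => i; apply: continuous_mul; first exact: continuous_cst.
  apply: continuous_rV_coord.
  apply: (@continuous_compose _ _ _ (fun q : R * 'rV[R]_n => (q.2, q.1))
    (fun p : 'rV[R]_n * R => system_rhs (u ^~ p.2) p.1) sw).
  exact: system_rhs_continuous.
have dW (t : R) : 0 < t -> is_derive t 1 W (\int[leb]_(x in Omega) dmass x t).
  exact: is_derive_integral.
have dW_le (t : R) : 0 < t -> \int[leb]_(x in Omega) dmass x t <= K * vol - l * W t.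
  move=> t0.
  have -> : \int[leb]_(x in Omega) dmass x t =
      \int[leb]_(x in Omega) \sum_i a i * f (u x t) ord0 i.
    under eq_Rintegral do rewrite dmass_split.
    rewrite RintegralD//; try exact: continuous_integrable.
    rewrite antisymmetric_integral ?add0r// => x y Ox Oy.
    rewrite /h -sumrN; apply: eq_bigr => i _ /=.
    by rewrite (phiC x y)//; ring.
  rewrite -Rintegral_cst// -RintegralZl//; last exact: continuous_integrable.
  have clm : continuous (fun x => l * mass x t).
    by apply: continuous_mul => //; exact: continuous_cst.
  rewrite -RintegralB//; try exact: continuous_integrable; last first.
    by apply: continuous_integrable => //; exact: continuous_cst.
  apply: le_Rintegral => //; try exact: continuous_integrable.
    apply: continuous_integrable => //; apply: continuous_sub => //.
    exact: continuous_cst.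
  by move=> x Ox; apply: bal; apply: unn; exact: ltW.
set CW := `|W 0| + K * vol / l.
have W_le t : 0 <= t -> W t <= CW.
  apply: (linear_comparison cW dW dW_le) => //; first by rewrite mulr_ge0.
  by move=> /lK ->; rewrite mul0r.
have CW0 : 0 <= CW by rewrite addr_ge0 ?divr_ge0// mulr_ge0.
have dmass_le x t : Omega x -> 0 < t ->
    dmass x t <= (dS * Phi * CW + K) - (dmin * eps + l) * mass x t.
  move=> Ox t0; rewrite dmass_split.
  have uxt := unn x t (ltW t0).
  have H1 : \int[leb]_(y in Omega) h t (x, y) <=
      dS * Phi * CW - dmin * eps * mass x t.
    (* Gain and loss are separated under the integral: the gain is integrated against the upper
       bound [dS * Phi], the loss keeps [phi] so that its integral can be bounded below by [eps]. *)
    apply: (@le_trans _ _ (dS * Phi * W t - dmin * mass x t *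
       \int[leb]_(y in Omega) phi x y)); last first.
      apply: lerB.
        by apply: ler_wpM2l; [exact: mulr_ge0|exact: W_le (ltW t0)].
      rewrite [leLHS]mulrAC; apply: ler_wpM2l; last exact: epsphi.
      by apply: mulr_ge0 => //; exact: mass0 (ltW t0).
    have c1 : continuous (fun y => dS * Phi * mass y t).
      by apply: continuous_mul => //; exact: continuous_cst.
    have c2 : continuous (fun y => dmin * mass x t * phi x y).
      by apply: continuous_mul => //; exact: continuous_cst.
    have chx : continuous (fun y => h t (x, y)).
      apply: (@continuous_compose _ _ _ (pair x) _ _ (ch t)).
      by apply: continuous_pair; [exact: continuous_cst|exact: continuous_id].
    rewrite -RintegralZl//; last exact: continuous_integrable.
    rewrite -RintegralZl//; last exact: continuous_integrable.
    rewrite -RintegralB//; try exact: continuous_integrable.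
    apply: le_Rintegral => //; try exact: continuous_integrable.
      by apply: continuous_integrable => //; exact: continuous_sub.
    move=> y Oy; rewrite /h /mass mulr_sumr mulrAC mulr_sumr -sumrB.
    apply: ler_sum => i _ /=.
    have uyt := unn y t (ltW t0) i; have := uxt i => uxti.
    (* [b1] enlarges the gain and [b2] reduces the loss; nonnegativity of [u] at both points is what
       permits this. *)
    have b1 : a i * u y t ord0 i * (d i * phi x y) <=
              a i * u y t ord0 i * (dS * Phi).
      by rewrite ler_wpM2l// mulr_ge0// ltW.
    have b2 : a i * u x t ord0 i * phi x y * dmin <=
              a i * u x t ord0 i * phi x y * d i.
      by rewrite ler_wpM2l// !mulr_ge0// ltW.
    by move: b1 b2; lra.
  have := bal _ uxt; move: H1; rewrite -/(mass x t).
  by rewrite mulrDl; lra.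
exists ((\sum_i a i) * Mv + (dS * Phi * CW + K) / (dmin * eps + l)).
move=> x t Ox t0.
have H := linear_comparison (cmass_t x) (dmassE x) (fun s => @dmass_le x s Ox).
apply: le_trans (H t _ _ _ _) _ => //.
- by rewrite addr_ge0 ?mulr_ge0.
- exact: ltW.
- by move=> E; move: rho0; rewrite E ltxx.
rewrite lerD2r ger0_norm ?mass0// /mass mulr_suml; apply: ler_sum => i _.
rewrite ler_wpM2l//; first exact: ltW.
apply: le_trans (uMv x).
by apply: le_trans (le_coord_rV_norm _ i); rewrite ler_norm.
Qed.

End solutions_of_the_system.

End nonlocal_system.

(** * Extension of the data and proof of the theorem *)

Lemma bounded_continuous_extension {R : realType} (X : pseudoMetricType R)
    (A : set X) (g : X -> R) :
  closed A -> compact A -> {within A, continuous g} ->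
  exists h M, [/\ continuous h, forall x, A x -> h x = g x & forall x, `|h x| <= M].
Proof.
move=> clA cA cg; have [M [M0 gM]] := compact_norm_bounded cA cg.
(* Tietze extension is applied with a positive bound, and [M] itself may be 0. *)
have M1 : 0 < M + 1 by rewrite ltr_wpDl.
have gM1 x : A x -> `|g x| <= M + 1.
  by move=> /gM H; apply: (le_trans H); rewrite lerDl.
have [h [hg ch hM]] := continuous_bounded_extension
  (pseudometric_normal (X := X)) clA M1 cg gM1.
exists h, (M + 1); split => // x Ax.
by rewrite hg// inE.
Qed.

Lemma bounded_continuous_extension_rV {R : realType} m (X : pseudoMetricType R)
    (A : set X) (g : X -> 'rV[R]_m) :
  closed A -> compact A -> {within A, continuous g} ->
  exists2 h, continuous h /\ (forall x, A x -> h x = g x) &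
    exists2 M : R, 0 <= M & forall x, `|h x| <= M.
Proof.
move=> clA cA cg.
have cgi i : {within A, continuous (fun x => g x ord0 i)}.
  exact: (@continuous_rV_coord _ _ (subspace A)).
have /choice[h Hh] i := bounded_continuous_extension clA cA (cgi i).
have {Hh}/choice[M HM] := Hh.
exists (fun x => \row_i h i x).
  split; first by apply: continuous_rV => i; under eq_fun do rewrite mxE;
    have [] := HM i.
  by move=> x Ax; apply/rowP => i; rewrite mxE; have [_ ->] := HM i.
exists (\sum_i `|M i|) => [|x]; first exact: sumr_ge0.
apply: rV_norm_le => [|i]; first exact: sumr_ge0.
rewrite mxE; have [_ _ /(_ x) hM] := HM i.
apply: (le_trans hM); apply: (le_trans (ler_norm _)).
by rewrite (bigD1 i)//= lerDl; exact: sumr_ge0.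
Qed.

Lemma continuous_eq_closure {R : realType} n m (A : set 'rV[R]_n)
    (g h : 'rV[R]_n -> 'rV[R]_m) : continuous g -> continuous h ->
  (forall x, A x -> g x = h x) -> forall x, closure A x -> g x = h x.
Proof.
move=> cg ch gh x Ax; apply/rowP => i; apply/eqP; rewrite -subr_eq0; apply/eqP.
have cc : continuous (fun x => g x ord0 i - h x ord0 i).
  by apply: continuous_sub; exact: continuous_rV_coord.
have cl : closed [set x | g x ord0 i - h x ord0 i = 0].
  by apply: (@closed_comp _ _ _ [set r : R | r = 0]) => // y _; exact: cc.
have sub : A `<=` [set x | g x ord0 i - h x ord0 i = 0].
  by move=> y /gh /= ->; rewrite subrr.
by move: Ax => /(closureS sub); rewrite -(proj1 (closure_id _) cl).
Qed.

Unset Implicit Arguments.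

Theorem theorem2p1 (R : realType) (n m : nat) (hn : (2 <= n)%N) (hm : (2 <= m)%N)
  (Omega : set 'rV[R]_n)
  (hOmega : bounded_domain Omega)
  (hsmooth : smooth_boundary_one_side Omega)
  (* (INIT) *)
  (v : 'rV[R]_n -> 'rV[R]_m)
  (hv : {within closure Omega, continuous v})
  (hv0 : forall x, closure Omega x -> orthant m (v x))
  (* (DIFF) *)
  (d : 'I_m -> R) (hd : forall i, 0 < d i)
  (phi : 'rV[R]_n -> 'rV[R]_n -> R)
  (hphi : {within closure Omega `*` closure Omega,
             continuous (fun p : 'rV[R]_n * 'rV[R]_n => phi p.1 p.2)})
  (hphi0 : forall x y, closure Omega x -> closure Omega y -> 0 <= phi x y)
  (hphiC : forall x y, Omega x -> Omega y -> phi x y = phi y x)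
  (eps mu : R) (heps : 0 <= eps) (hmu : 0 <= mu)
  (hphi_int : forall x, Omega x ->
     eps <= \int[lebesgue_rV R n]_(y in Omega) phi x y <= mu)
  (* (F) *)
  (f : 'rV[R]_m -> 'rV[R]_m)
  (hf : exists C : 'rV[R]_m -> 'rV[R]_m -> R,
     [/\ continuous (fun p : 'rV[R]_m * 'rV[R]_m => C p.1 p.2),
         forall y w, 0 <= C y w &
         forall y w, `|f y - f w| <= C y w * `|y - w|])
  (* (QP) *)
  (hQP : forall i y, orthant m y -> y ord0 i = 0 -> 0 <= f y ord0 i)
  (* (QBAL) *)
  (a : 'I_m -> R) (K L : R) (ha : forall i, 0 < a i) (hK : 0 <= K)
  (hQBAL : forall y, orthant m y ->
     \sum_(i < m) a i * f y ord0 i <= K + L * \sum_(i < m) y ord0 i) :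
  exists u : 'rV[R]_n -> R -> 'rV[R]_m,
    [/\ classical_solution Omega d phi f v +oo%E u,
        nonneg_solution Omega +oo%E u,
        forall w : 'rV[R]_n -> R -> 'rV[R]_m,
          classical_solution Omega d phi f v +oo%E w ->
          nonneg_solution Omega +oo%E w ->
          forall x t, closure Omega x -> 0 <= t -> w x t = u x t &
        (0 < eps /\ K = 0 /\ L = 0) \/ L < 0 ->
        (ereal_sup [set sup_norm Omega (u ^~ t) | t in [set t | (0 <= t)%R]]
           < +oo)%E].
Proof.
have [_ oOmega _ bOmega] := hOmega.
have subcl : Omega `<=` closure Omega by exact: subset_closure.
have clO : closed (closure Omega) by exact: closed_closure.
have cO : compact (closure Omega) by exact: closure_bounded_compact.
have cO2 : compact (closure Omega `*` closure Omega) by exact: compact_setX.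
have clO2 : closed (closure Omega `*` closure Omega).
  by apply: compact_closed cO2; exact: norm_hausdorff.
have [phi1 [Phi [cphi1 phi1E phi1M]]] := bounded_continuous_extension clO2 cO2 hphi.
(* The extension may take negative values; its positive part is still continuous and bounded and
   agrees with [phi] on the closure. Symmetry is kept on [Omega] only, which is where it is
   integrated. *)
pose psi x y := Num.max 0 (phi1 (x, y)).
have cpsi : continuous (fun p => psi p.1 p.2).
  apply: continuous_maxr; first exact: continuous_cst.
  have -> : (fun p => phi1 (p.1, p.2)) = phi1 by apply/funext => -[].
  exact: cphi1.
have psi0 x y : 0 <= psi x y by rewrite le_max lexx.
have psiPhi x y : psi x y <= Phi.
  have := phi1M (x, y); rewrite ge_max => H; apply/andP; split.
    exact: le_trans H.
  exact: le_trans (ler_norm _) H.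
have psiE x y : closure Omega x -> closure Omega y -> psi x y = phi x y.
  by move=> xO yO; rewrite /psi phi1E// max_r// hphi0.
have [v1 [cv1 v1E] [Mv Mv0 HMv]] := bounded_continuous_extension_rV clO cO hv.
pose v2 x : 'rV[R]_m := \row_i Num.max 0 (v1 x ord0 i).
have cv2 : continuous v2.
  apply: continuous_rV => i; rewrite /v2; under eq_fun do rewrite mxE.
  by apply: continuous_maxr; [exact: continuous_cst|exact: continuous_rV_coord].
have v20 x : orthant m (v2 x) by move=> i; rewrite mxE le_max lexx.
have v2M x : `|v2 x| <= Mv.
  apply: rV_norm_le => // i; rewrite mxE ger0_norm ?le_max ?lexx// ge_max Mv0.
  by apply: le_trans (ler_norm _) (le_trans (le_coord_rV_norm _ _) (HMv x)).
have v2E x : closure Omega x -> v2 x = v x.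
  by move=> xO; apply/rowP => i; rewrite mxE v1E// max_r// hv0.
have [u [cu u0 du unn]] := system_existence oOmega bOmega hd cpsi psi0 psiPhi
  hf cv2 (ex_intro2 _ _ Mv Mv0 v2M) v20 hQP ha hK hQBAL.
(* For x in [Omega] the right-hand side involves only values over [Omega], so the extended and the
   original data give the same system there. *)
have rhsE (w w' : 'rV[R]_n -> 'rV[R]_m) x i : Omega x ->
    (forall y, Omega y -> w y = w' y) ->
    system_rhs Omega d psi f w x ord0 i =
    \int[lebesgue_rV R n]_(y in Omega) (d i * phi x y * (w' y ord0 i - w' x ord0 i))
      + f (w' x) ord0 i.
  move=> Ox ww'; rewrite mxE ww'//; congr (_ + _).
  apply: eq_Rintegral => y /set_mem Oy.
  by rewrite psiE ?ww'//; exact: subcl.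
have du' x (t : R) i : 0 < t -> is_derive t 1 (fun s => u x s ord0 i)
    (system_rhs Omega d psi f (u ^~ t) x ord0 i).
  move=> t0; apply: has_derivative_in_is_derive => //.
  by apply: du; exact: ltW.
exists u; split.
- split.
  + move=> i; split.
      apply: continuous_subspaceT.
      by apply: continuous_rV_coord; exact: cu.
    exists (fun x t => system_rhs Omega d psi f (u ^~ t) x ord0 i); split.
      apply: continuous_subspaceT; apply: continuous_rV_coord.
      exact: (system_rhs_continuous oOmega bOmega cpsi hf cu).
    by move=> x t _ /time_intervaly t0; exact: du.
  + move=> x t i Ox /time_intervaly t0.
    by rewrite -(rhsE (u ^~ t) (u ^~ t))//; exact: du.
  + by move=> x i Ox; rewrite u0 v2E//; exact: subcl.
- by move=> x t _ /time_intervaly; exact: unn.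
- move=> w [wC wd w0] _ x t xO t0.
  set T := t + 1.
  have tT : t < T by rewrite ltrDl.
  have cK : compact (closure Omega `*` `[0, T]%classic).
    by apply: compact_setX => //; exact: segment_compact.
  have clK : closed (closure Omega `*` `[0, T]%classic).
    by apply: compact_closed cK; exact: norm_hausdorff.
  have cw : {within closure Omega `*` `[0, T]%classic,
      continuous (fun p : 'rV[R]_n * R => w p.1 p.2)}.
    apply: (@continuous_rV R m (subspace (closure Omega `*` `[0, T]%classic))) => i.
    have [H _] := wC i; apply: continuous_subspaceW H.
    move=> [y s] [/= Oy]; rewrite in_itv/= => /andP[s0 _]; split => //.
    exact/time_intervaly.
  (* [w] is continuous only over the closure and for nonnegative times; on a compact cylinder it is
     replaced by a globally continuous function, as [system_uniqueness] requires. *)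
  have [z [cz zE] _] := bounded_continuous_extension_rV clK cK cw.
  have zw y s : closure Omega y -> 0 <= s -> s <= T -> z (y, s) = w y s.
    by move=> yO s0 sT; apply: (zE (y, s)); split => //=; rewrite in_itv/= s0.
  pose z' y s := z (y, s).
  have cz' : jointly_continuous z'.
    rewrite /jointly_continuous /z'.
    by have -> : (fun p => z (p.1, p.2)) = z by apply/funext => -[].
  have uz' : forall y s, Omega y -> 0 <= s -> s <= T -> u y s = z' y s.
    apply: (system_uniqueness oOmega bOmega hd cpsi psi0 psiPhi hf cu cz').
    + move=> y Oy; rewrite /z' zw//; [|exact: subcl|by rewrite addr_ge0].
      by apply/rowP => i; rewrite w0// u0 v2E//; exact: subcl.
    + by move=> y s i _ s0 _; exact: du'.
    + move=> y s i Oy s0 sT.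
      rewrite (rhsE _ (w ^~ s))//; last first.
        by move=> q Oq; apply: zw; [exact: subcl|exact: ltW|exact: ltW].
      have Js : time_interval (+oo%E : \bar R) s.
        by apply/time_intervaly; exact: ltW.
      have D := has_derivative_in_is_derive s0 (wd y s i Oy Js).
      (* As [s] lies strictly between 0 and [T], the extension coincides with [w] at all times near
         [s] and has the same derivative. *)
      apply: near_eq_is_derive D.
      near=> r; rewrite /z' zw//; first exact: subcl.
        by near: r; apply: (cvgr_ge s (@continuous_id R s)).
      by near: r; apply: (cvgr_le s (@continuous_id R s)).
  rewrite -zw//; last exact: ltW.
  apply: (@continuous_eq_closure _ _ _ Omega (z' ^~ t) (u ^~ t)) => //.
  + exact: jointly_continuous_slice.
  + exact: jointly_continuous_slice.
  + by move=> y Oy; rewrite uz'//; exact: ltW.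
- move=> hbound.
  have [dmin dmin0 dmin_le] := positive_lower_bound hd.
  have [amin amin0 amin_le] := positive_lower_bound ha.
  have psiC x y : Omega x -> Omega y -> psi x y = psi y x.
    move=> Ox Oy; have xO : closure Omega x by exact: subcl.
    have yO : closure Omega y by exact: subcl.
    by rewrite (psiE x y xO yO) (psiE y x yO xO); exact: hphiC.
  have epspsi x : Omega x -> eps <= \int[lebesgue_rV R n]_(y in Omega) psi x y.
    move=> Ox; have /andP[H _] := hphi_int x Ox; apply: (le_trans H).
    rewrite le_eqVlt; apply/orP; left; apply/eqP; apply: eq_Rintegral => y /set_mem Oy.
    by rewrite psiE//; exact: subcl.
  (* The balance condition bounds by the plain sum of the components, the mass estimate by the
     weighted one. Since each [a i <= asum] and [L <= 0], the rate [- L / asum] works for the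
     weighted sum; the 1 makes [asum] positive without a case distinction. *)
  pose asum := 1 + \sum_i a i.
  have asum0 : 0 < asum.
    by rewrite ltr_wpDr//; apply: sumr_ge0 => i _; exact: ltW.
  have a_asum i : a i <= asum.
    rewrite /asum (bigD1 i)//= addrCA lerDl addr_ge0//.
    by apply: sumr_ge0 => j _; exact: ltW.
  have L0 : L <= 0 by case: hbound => [[_ [_ ->]]|/ltW].
  have bal y : orthant m y -> \sum_(i < m) a i * f y ord0 i <=
      K - (- L / asum) * \sum_(i < m) a i * y ord0 i.
    move=> y0; apply: (le_trans (hQBAL y y0)); rewrite lerD2l mulNr mulNr opprK.
    rewrite -subr_le0 -mulrA -mulrBr mulr_le0_ge0// subr_ge0.
    rewrite mulrC ler_pdivrMr// mulr_suml; apply: ler_sum => i _.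
    by rewrite mulrC ler_wpM2l//; exact: y0.
  have l0 : 0 <= - L / asum by rewrite divr_ge0 ?oppr_ge0// ltW.
  have lK : - L / asum = 0 -> K = 0.
    case: hbound => [[_ [-> _]]//|Ln] /eqP.
    by rewrite mulf_eq0 oppr_eq0 invr_eq0 (lt_eqF Ln) (gt_eqF asum0).
  (* The two alternatives of the hypothesis meet here: either [eps] or [- L] makes the decay rate
     positive. *)
  have rho0 : 0 < dmin * eps + - L / asum.
    case: hbound => [[e0 _]|Ln].
      by rewrite ltr_wpDr// mulr_gt0.
    by rewrite ltr_wpDl ?mulr_ge0// ?divr_gt0 ?oppr_gt0// ltW.
  have uMv x : `|u x 0| <= Mv by rewrite u0.
  have [C HC] := system_mass_bounded oOmega bOmega hd cpsi psi0 psiPhi hf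
    psiC epspsi dmin_le (ltW dmin0) ha hK l0 lK rho0 bal cu uMv du' unn.
  (* One component times [amin] is at most the mass, hence at most [C]. *)
  apply: (@le_lt_trans _ _ (`|C| / amin)%:E); last by rewrite ltry.
  apply: ge_ereal_sup => _ [t /= t0 <-].
  apply: ge_ereal_sup => _ [x Ox <-]; rewrite lee_fin.
  apply: rV_norm_le => [|i]; first by rewrite divr_ge0// ltW.
  rewrite ger0_norm ?unn// ler_pdivlMr//.
  apply: (le_trans _ (ler_norm C)); apply: le_trans (HC x t Ox t0).
  rewrite (bigD1 i)//= mulrC; apply: (@le_trans _ _ (a i * u x t ord0 i)).
    by rewrite ler_wpM2r//; exact: unn.
  by rewrite lerDl; apply: sumr_ge0 => j _; rewrite mulr_ge0 ?unn// ltW.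
Unshelve. all: by end_near. Qed.
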